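(* Let $\varphi$ be a non-constant inner function on the unit disk $\mathbb{D}$, and let $M_\varphi$ be the associated multiplier on $H^2(\mathbb{D})$, defined by $M_\varphi(f)=\varphi f$. Then $\bigcap_{\lambda>1}HC(\lambda M_\varphi^* )$ is a residual set in $H^2(\mathbb{D})$.
   Context: $H^2(\mathbb{D})$ is the Hardy space on the unit disk $\mathbb{D}$ and $M_\varphi^*$ is the Hilbert space adjoint of $M_\varphi$. For a continuous linear operator $R$ on a topological vector space $X$, $HC(R)$ denotes the set of hypercyclic vectors for $R$, i.e. the vectors $x\in X$ such that $\{R^nx:\ n\geq1\}$ is dense in $X$. Here $\lambda$ ranges over real numbers $>1$. ''Residual set'' means dense $G_\delta$ set. *)

(* Defs.v *)
From HB Require Import structures.
From mathcomp Require Import all_boot all_order all_algebra.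
From mathcomp Require Import complex.
From mathcomp Require Import all_classical all_reals all_analysis.
From mathcomp Require Import borel_hierarchy.
From mathcomp Require Import ring lra.

Set Implicit Arguments.
Unset Strict Implicit.
Unset Printing Implicit Defensive.

Import Order.TTheory GRing.Theory Num.Theory.
Import numFieldNormedType.Exports.
Import Normc.

Local Open Scope classical_set_scope.
Local Open Scope complex_scope.
Local Open Scope ring_scope.

(* The topology of [R[i]] is the one given by its modulus. *)
HB.instance Definition _ (R : realType) := NormedModule.copy R[i] (R[i])^o.

Section PowerSeries.
Context {R : realType}.
Implicit Types (f : R[i] -> R[i]) (a b : nat -> R[i]).

(* Functions on the open unit disk are represented by total functions on
   [R[i]], of which only the values at the points [`|z| < 1] matter. *)
Definition power_series_on_disk a f :=
  forall z : R[i], `|z| < 1 -> series (fun n => a n * z ^+ n) @ \oo --> f z.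

Definition analytic_on_disk f := exists a, power_series_on_disk a f.

Definition bounded_on_disk f :=
  exists M : R, forall z : R[i], `|z| < 1 -> `|f z| <= M%:C.

Definition constant_on_disk f :=
  exists c : R[i], forall z : R[i], `|z| < 1 -> f z = c.

Definition expi (t : R) : R[i] := cos t +i* sin t.

Definition inner_function f :=
  [/\ analytic_on_disk f, bounded_on_disk f &
    {ae (@lebesgue_measure R), forall t : R, t \in `[0, 2 * pi] ->
       exists2 w : R[i], `|w| = 1 & f (r%:C * expi t) @[r --> 1^'-] --> w}].

(* The sequence of Taylor coefficients at 0 of [f] when
   [f] is analytic on the disk (it is then unique), and 0 otherwise. *)
Definition taylor_coef f : nat -> R[i] :=
  xget (fun=> 0) [set a | power_series_on_disk a f].

Definition sqsum a : nat -> R := series (fun n => normc (a n) ^+ 2).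

Definition square_summable a := cvgn (sqsum a).

Definition l2norm a : R := Num.sqrt (limn (sqsum a)).

Lemma normcC (z : R[i]) : `|z| = (normc z)%:C.
Proof. by []. Qed.

Lemma normc_ge0 (z : R[i]) : 0 <= normc z.
Proof. by rewrite -lecR -normcC normr_ge0. Qed.

Lemma normc_triangle (x y : R[i]) : normc (x + y) <= normc x + normc y.
Proof. by rewrite -lecR rmorphD /=; exact: (@ler_normD _ R[i]). Qed.

Lemma normc_opp (z : R[i]) : normc (- z) = normc z.
Proof. by case: z => x y /=; rewrite !sqrrN. Qed.

Lemma sqsum0 a : sqsum a 0%N = 0.
Proof. by rewrite /sqsum seriesEnat /= big_geq. Qed.

Lemma sqsumS a n : sqsum a n.+1 = sqsum a n + normc (a n) ^+ 2.
Proof. by rewrite /sqsum seriesSr. Qed.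

Lemma sqsum_ge0 a n : 0 <= sqsum a n.
Proof.
by elim: n => [|n IH]; rewrite ?sqsum0 // sqsumS addr_ge0 // sqr_ge0.
Qed.

Lemma sqsum_nd a : nondecreasing_seq (sqsum a).
Proof.
by apply/nondecreasing_seqP => n; rewrite sqsumS lerDl sqr_ge0.
Qed.

Lemma sqsum_le a n : square_summable a -> Num.sqrt (sqsum a n) <= l2norm a.
Proof.
by move=> ca; apply: ler_wsqrtr; exact: nondecreasing_cvgn_le (sqsum_nd a) ca n.
Qed.

Lemma sqsum_bound a M : 0 <= M -> (forall n, Num.sqrt (sqsum a n) <= M) ->
  square_summable a /\ l2norm a <= M.
Proof.
move=> M0 H.
have H2 n : sqsum a n <= M ^+ 2.
  by rewrite -(sqr_sqrtr (sqsum_ge0 a n)) ler_sqr // nnegrE ?sqrtr_ge0.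
have ca : square_summable a.
  apply: nondecreasing_is_cvgn; first exact: sqsum_nd.
  by exists (M ^+ 2) => _ [n _ <-].
split=> //; rewrite /l2norm -[M]ger0_norm // -sqrtr_sqr ler_wsqrtr //.
by apply: limr_le => //; apply: nearW.
Qed.

Lemma l2norm_ge0 a : 0 <= l2norm a. Proof. exact: sqrtr_ge0. Qed.

Lemma sqsumD a b n : Num.sqrt (sqsum (a \+ b) n) <=
  Num.sqrt (sqsum a n) + Num.sqrt (sqsum b n).
Proof.
elim: n => [|n IH]; first by rewrite !sqsum0 sqrtr0 addr0.
rewrite !sqsumS /=.
set A := Num.sqrt (sqsum a n) in IH *; set B := Num.sqrt (sqsum b n) in IH *.
have -> : sqsum a n = A ^+ 2 by rewrite sqr_sqrtr ?sqsum_ge0.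
have -> : sqsum b n = B ^+ 2 by rewrite sqr_sqrtr ?sqsum_ge0.
apply: le_trans (normc_triangle (A +i* normc (a n)) (B +i* normc (b n))).
rewrite /= ler_wsqrtr // lerD //.
  rewrite -(sqr_sqrtr (sqsum_ge0 _ n)) ler_sqr // nnegrE ?sqrtr_ge0 //.
  by rewrite addr_ge0 ?sqrtr_ge0.
by rewrite ler_sqr ?nnegrE ?addr_ge0 ?normc_ge0 // normc_triangle.
Qed.

Lemma l2normD a b : square_summable a -> square_summable b ->
  square_summable (a \+ b) /\ l2norm (a \+ b) <= l2norm a + l2norm b.
Proof.
move=> ca cb; apply: sqsum_bound; first by rewrite addr_ge0 ?l2norm_ge0.
by move=> n; apply: le_trans (sqsumD a b n) _; rewrite lerD ?sqsum_le.
Qed.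

Lemma sqsumZ l a n :
  sqsum (fun k => l * a k) n = normc l ^+ 2 * sqsum a n.
Proof.
elim: n => [|n IH]; first by rewrite !sqsum0 mulr0.
by rewrite !sqsumS IH normcM exprMn mulrDr.
Qed.

Lemma l2normZ l a : square_summable a ->
  square_summable (fun n => l * a n) /\
  l2norm (fun n => l * a n) = normc l * l2norm a.
Proof.
move=> ca.
have E : sqsum (fun n => l * a n) = (fun n => normc l ^+ 2 * sqsum a n).
  by apply/funext => n; exact: sqsumZ.
split; first by rewrite /square_summable E; exact: is_cvgMl_tmp.
rewrite /l2norm E (_ : limn _ = normc l ^+ 2 * limn (sqsum a)); last first.
  by apply: cvg_lim => //; exact: cvgMl_tmp.
by rewrite sqrtrM ?sqr_ge0 // sqrtr_sqr ger0_norm // normc_ge0.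
Qed.

Lemma l2norm_eq0 a : square_summable a -> l2norm a = 0 -> forall n, a n = 0.
Proof.
move=> ca a0 n; apply: eq0_normc.
have := sqsum_le n.+1 ca; rewrite a0 -[_ <= 0]andbT -(sqrtr_ge0 (sqsum a n.+1)) -eq_le.
rewrite sqrtr_eq0 sqsumS => h.
apply/eqP; rewrite -sqrf_eq0; apply/eqP/le_anti; rewrite sqr_ge0 andbT.
by apply: le_trans h; rewrite lerDr sqsum_ge0.
Qed.

Lemma power_series0 : power_series_on_disk (fun=> 0) (fun=> 0).
Proof.
move=> z _; rewrite (_ : series _ = fun=> 0); first exact: cvg_cst.
by apply/funext => n; rewrite seriesEnat /= big1 // => i _; rewrite mul0r.
Qed.

Lemma power_seriesD a b f g :
  power_series_on_disk a f -> power_series_on_disk b g ->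
  power_series_on_disk (a \+ b) (f \+ g).
Proof.
move=> fa gb z z1.
rewrite (_ : (fun n => _) = (fun n => a n * z ^+ n) + (fun n => b n * z ^+ n)).
  by rewrite seriesD; apply: cvgD; [exact: fa|exact: gb].
by apply/funext => n; rewrite /= mulrDl.
Qed.

Lemma power_seriesZ (l : R[i]) a f :
  power_series_on_disk a f ->
  power_series_on_disk (fun n => l * a n) (fun z => l * f z).
Proof.
move=> fa z z1.
rewrite (_ : series _ = (fun n => l * series (fun n => a n * z ^+ n) n)).
  by apply: (@cvgMl_tmp R[i] nat \oo _ _ l (f z)); exact: fa.
apply/funext => n; rewrite !seriesEnat /= mulr_sumr.
by apply: eq_bigr => i _; rewrite mulrA.
Qed.

Lemma power_series_eq0 a : power_series_on_disk a (fun=> 0) ->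
  forall n, a n = 0.
Proof.
move=> a0.
have half1 : `|(2^-1 : R)%:C| < 1 :> R[i].
  rewrite normcC /= expr0n /= addr0 sqrtr_sqr ger0_norm // ltcR.
  by rewrite invf_lt1 // ltr1n.
have [M M0 HM] : exists2 M : R, 0 < M & forall n, normc (a n) <= M * 2 ^+ n.
  have /cvg_series_cvg_0 cz : cvgn (series (fun n => a n * ((2^-1)%:C) ^+ n)).
    by apply/cvg_ex; exists 0; exact: a0 half1.
  have /cvg_seq_bounded /ex_strict_bound_gt0 [m m0 Hm] :
    cvgn (fun n => a n * ((2^-1 : R)%:C) ^+ n) by apply/cvg_ex; exists 0.
  have mE : m = (complex.Re m)%:C by rewrite RRe_real // gtr0_real.
  exists (complex.Re m); first by rewrite -ltcR -mE.
  move=> n.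
  have : (normc (a n * (2^-1 : R)%:C ^+ n))%:C < m := Hm n I.
  rewrite mE ltcR normcM => /ltW.
  rewrite -rmorphXn /= expr0n /= addr0 sqrtr_sqr ger0_norm ?exprn_ge0 //.
  by rewrite exprVn ler_pdivrMr // exprn_gt0.
elim/ltn_ind => k IH; apply: contrapT => /eqP ak0.
have d0 : 0 < normc (a k).
  rewrite lt_def normc_ge0 andbT; apply: contra ak0 => /eqP/eq0_normc ->.
  by [].
set d := normc (a k) in d0 *.
pose t : R := Num.min (4^-1) (d / (8 * M * 2 ^+ k)).
have P0 : 0 < 8 * M * 2 ^+ k by rewrite !mulr_gt0 ?exprn_gt0.
have t0 : 0 < t by rewrite lt_min invr_gt0 ltr0n /= divr_gt0.
have t4 : t <= 4^-1 by rewrite ge_min lexx.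
have td : 8 * M * 2 ^+ k * t <= d.
  by rewrite mulrC -ler_pdivlMr // ge_min lexx orbT.
have t1 : `|t%:C| < 1 :> R[i].
  rewrite normcC /= expr0n /= addr0 sqrtr_sqr gtr0_norm // ltcR.
  by apply: le_lt_trans t4 _; rewrite invf_lt1 // ltr1n.
have normct n : normc ((t%:C : R[i]) ^+ n) = t ^+ n.
  by rewrite -rmorphXn /= expr0n /= addr0 sqrtr_sqr gtr0_norm // exprn_gt0.
pose q := 2 * t.
have q0 : 0 < q by rewrite mulr_gt0.
have q1 : 2 * q <= 1 by rewrite /q; move: t4; lra.
pose S := series (fun n => a n * (t%:C) ^+ n).
have Sk m : normc (S (k.+1 + m)%N - a k * t%:C ^+ k) <=
    M * q ^+ k.+1 * (2 * (1 - q ^+ m)).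
  elim: m => [|m IHm].
    rewrite addn0 expr0 subrr !mulr0 /S seriesSr.
    rewrite (_ : series _ k = 0) ?add0r ?subrr ?normc0 //.
    rewrite seriesEnat /= big_nat big1 // => i /andP[_ ik].
    by rewrite IH // mul0r.
  rewrite addnS /S seriesSr addrAC.
  apply: le_trans (normc_triangle _ _) _.
  apply: le_trans (lerD IHm (lexx _)) _.
  rewrite normcM normct.
  have h : normc (a (k.+1 + m)%N) * t ^+ (k.+1 + m) <= M * q ^+ k.+1 * q ^+ m.
    rewrite -mulrA -exprD /q exprMn mulrA ler_wpM2r ?exprn_ge0 // ltW //.
  apply: le_trans (lerD (lexx _) h) _.
  have Mq : 0 <= M * q ^+ k.+1 by rewrite ltW // mulr_gt0 // exprn_gt0.
  rewrite -mulrDr ler_wpM2l //.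
  have : q ^+ m * (2 * q) <= q ^+ m by rewrite ler_piMr // exprn_ge0 // ltW.
  rewrite [q ^+ m.+1]exprS; move: (q ^+ m) => y hy.
  have -> : 2 * (1 - q * y) = 2 - y * (2 * q) by ring.
  by move: (y * (2 * q)) hy => w hw; lra.
have e0 : 0 < d * t ^+ k - 2 * (M * q ^+ k.+1).
  have -> : 2 * (M * q ^+ k.+1) = (4 * M * 2 ^+ k * t) * t ^+ k.
    by rewrite /q exprMn !exprS; ring.
  by rewrite -mulrBl mulr_gt0 ?exprn_gt0 //; move: td d0; lra.
have eC : 0 < (d * t ^+ k - 2 * (M * q ^+ k.+1))%:C :> R[i] by rewrite ltcR.
have /cvgrPdist_lt /(_ _ eC) [N _ HN] := a0 _ t1.
have := HN (k.+1 + N)%N (leq_addl _ _); rewrite sub0r normrN normcC ltcR.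
rewrite -/S => hS.
have := Sk N; set x := S _ in hS * => hx.
have : d * t ^+ k <= normc x + normc (x - a k * t%:C ^+ k).
  rewrite /d -normct -normcM.
  rewrite [X in normc X <= _](_ : _ = x + - (x - a k * t%:C ^+ k)); last by ring.
  by apply: le_trans (normc_triangle _ _) _; rewrite normc_opp.
have : M * q ^+ k.+1 * (2 * (1 - q ^+ N)) <= 2 * (M * q ^+ k.+1).
  have Mq : 0 <= M * q ^+ k.+1 by rewrite ltW // mulr_gt0 // exprn_gt0.
  rewrite [leRHS]mulrC ler_wpM2l // ler_piMr // gerBl exprn_ge0 //.
  exact: ltW.
move: hS hx.
move: (normc x) (normc (x - _)) (d * t ^+ k) (M * q ^+ k.+1 * _).
by move: (M * q ^+ k.+1) => u v w y z; lra.
Qed.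

Lemma power_series_uniq a b f :
  power_series_on_disk a f -> power_series_on_disk b f -> a = b.
Proof.
move=> fa fb; apply/funext => n; apply/eqP; rewrite -subr_eq0; apply/eqP.
have := @power_series_eq0 (a \+ (fun n => -1 * b n)).
move=> /(_ _ n) /= <-; first by rewrite mulN1r.
have -> : (fun=> 0) = f \+ (fun z => -1 * f z).
  by apply/funext => z /=; rewrite mulN1r subrr.
exact: power_seriesD fa (power_seriesZ (l := -1) fb).
Qed.

Lemma taylor_coefE a f : power_series_on_disk a f -> taylor_coef f = a.
Proof.
move=> fa; apply: (power_series_uniq (f := f)) => //.
exact: (xgetPex (fun=> 0) (ex_intro [set a | power_series_on_disk a f] a fa)).
Qed.

End PowerSeries.

Section HardySpace.
Context (R : realType).

(* The extension by zero outside the disk makes the representation of a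
   function on the disk by a function on [R[i]] unique. *)
Definition hardy2 : {pred R[i] -> R[i]} := mem
  [set f : R[i] -> R[i] |
    (forall z, ~~ (`|z| < 1) -> f z = 0) /\
    exists2 a, power_series_on_disk a f & square_summable a].

Record H2 := MkH2 { H2val :> R[i] -> R[i] ; _ : H2val \in hardy2 }.

HB.instance Definition _ := [isSub for H2val].
HB.instance Definition _ := [Choice of H2 by <:].

Lemma hardy2_submod_closed : submod_closed hardy2.
Proof.
split.
  apply: mem_set; split=> //.
  exists (fun=> 0); first exact: power_series0.
  rewrite /square_summable (_ : sqsum _ = fun=> 0); first exact: is_cvg_cst.
  apply/funext; elim=> [|n IH]; first by rewrite sqsum0.
  by rewrite sqsumS IH normc0 expr0n addr0.
move=> l f g /set_mem[f0 [a fa ca]] /set_mem[g0 [b gb cb]].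
apply: mem_set; split.
  move=> z z1; have -> : (l *: f + g) z = l * f z + g z by [].
  by rewrite f0 // g0 // mulr0 addr0.
exists ((fun n => l * a n) \+ b).
  rewrite (_ : l *: f + g = (fun z => l * f z) \+ g); last by [].
  exact: power_seriesD (power_seriesZ (l := l) fa) gb.
exact: (l2normD (l2normZ l ca).1 cb).1.
Qed.

HB.instance Definition _ :=
  GRing.isSubmodClosed.Build _ _ hardy2 hardy2_submod_closed.
HB.instance Definition _ := [SubChoice_isSubLmodule of H2 by <:].

Implicit Types f g : H2.

Lemma H2_taylor f :
  power_series_on_disk (taylor_coef f) f /\ square_summable (taylor_coef f).
Proof.
by case: f => f /= /set_mem[_ [a fa ca]]; rewrite (taylor_coefE fa).
Qed.

Lemma taylor_coefD f g :
  taylor_coef (f + g : H2) = taylor_coef f \+ taylor_coef g.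
Proof.
apply: taylor_coefE.
rewrite (_ : H2val (f + g) = (H2val f \+ H2val g)); last by [].
exact: power_seriesD (H2_taylor f).1 (H2_taylor g).1.
Qed.

Lemma taylor_coefZ (l : R[i]) f :
  taylor_coef (l *: f : H2) = (fun n => l * taylor_coef f n).
Proof. by apply: taylor_coefE; exact: power_seriesZ (H2_taylor f).1. Qed.

Definition H2norm f : R[i] := (l2norm (taylor_coef f))%:C.

Lemma H2norm_triangle f g : H2norm (f + g) <= H2norm f + H2norm g.
Proof.
rewrite /H2norm taylor_coefD -rmorphD lecR.
exact: (l2normD (H2_taylor f).2 (H2_taylor g).2).2.
Qed.

Lemma H2normZ (l : R[i]) f : H2norm (l *: f) = `|l| * H2norm f.
Proof.
by rewrite /H2norm taylor_coefZ (l2normZ l (H2_taylor f).2).2 rmorphM.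
Qed.

Lemma H2norm_eq0 f : H2norm f = 0 -> f = 0.
Proof.
move=> [f0]; apply: val_inj; apply/funext => z /=.
have [z1|z1] := boolP (`|z| < 1); last first.
  by case: f {f0} => f /= /set_mem[+ _]; exact.
have := (H2_taylor f).1 z z1.
have -> : taylor_coef f = fun=> 0.
  by apply/funext; exact: l2norm_eq0 (H2_taylor f).2 f0.
move=> fz; apply: (cvg_unique _ fz); first exact: norm_hausdorff.
exact: power_series0 z z1.
Qed.

HB.instance Definition _ :=
  Lmodule_isNormed.Build R[i] H2 H2norm_triangle H2normZ H2norm_eq0.

Definition H2_inner f g : R[i] :=
  limn (series (fun n => taylor_coef f n * (taylor_coef g n)^*)).

(* [A^*] is characterized by [<A f, g> = <f, A^* g>]; the default value 0
   is only used when no such vector exists, i.e. not for bounded [A]. *)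
Definition H2_adjoint (A : H2 -> H2) (g : H2) : H2 :=
  xget 0 [set h : H2 | forall f, H2_inner (A f) g = H2_inner f h].

(* [phi * f] belongs to the Hardy space whenever [phi] is bounded and
   analytic on the disk; [insubd] only returns its default value 0 otherwise. *)
Definition multiplier (phi : R[i] -> R[i]) (f : H2) : H2 :=
  insubd (0 : H2) (fun z => phi z * f z).

End HardySpace.

Section Hypercyclic.
Context {X : topologicalType}.

Definition hypercyclic_vectors (T : X -> X) : set X :=
  [set x | dense [set iter n T x | n in [set n | (1 <= n)%N]]].

Definition residual (S : set X) := dense S /\ Gdelta S.

End Hypercyclic.

(* Main.v *)
Require Import Defs.
From HB Require Import structures.
From mathcomp Require Import all_boot all_order all_algebra.
From mathcomp Require Import complex.
From mathcomp Require Import all_classical all_reals all_analysis.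
From mathcomp Require Import borel_hierarchy measurable_realfun.
From mathcomp Require Import ring lra.
Import Order.TTheory GRing.Theory Num.Theory.
Import numFieldNormedType.Exports.
Import Normc.
Local Open Scope classical_set_scope.
Local Open Scope complex_scope.
Local Open Scope ring_scope.

(* Since [|phi| = 1] almost everywhere on the circle, Parseval's identity and
   dominated convergence along the radii show that [S := M_phi] is an isometry
   of the Hardy space, so [T := M_phi^*] is a contraction with [T S = 1].  On
   monomials [T] is triangular with diagonal entries the conjugate of [phi 0],
   and [|phi 0| < 1] because [phi] has norm 1 and is not constant; hence
   [T^n f] tends to 0 for every [f], and [f - S^n T^n f] is in the kernel of
   [T^n], so the union of these kernels is dense.  Costakis and Sambarino's
   construction then applies: for [y], [z] in the kernel of [T^N] and a grid
   [a = l_0 <= l_1 <= ...], the vector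
   [y + \sum_k l_k^(-(k+1)N) S^((k+1)N) z] is close to [y], and [(l T)^((k+1)N)]
   sends it close to [z] for every [l] between [l_k] and [l_(k+1)].  Baire's
   theorem concludes. *)

(** * Real-valued norms and Baire's theorem *)

(** The intersection runs over uncountably many [l], which Baire's theorem does not reach directly.
    So one vector has to serve every [l] of a compact interval [[a, b]] with [a > 1], and
    compactness of [[a, b]] makes the set of such vectors open. A power [l ^+ n] with [n = (k+1) N]
    is sensitive to [l]: two neighbouring grid points stay interchangeable only if their ratio is
    about [1 + d / ((k+1) N)]. Since the times grow only linearly in [k], such ratios still multiply
    to infinity, and the grid passes [b]. The gap between [a] and 1 makes the terms of the vector
    decay geometrically, once [N] is so large that [a ^+ N >= 2]. On the analytic side, boundary
    values are used for [phi] alone, where the definition of an inner function supplies them. The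
    isometry is first obtained on polynomials, which extend continuously to the circle, and reaches
    the other functions by completeness. The adjoint is defined by a choice, so its existence
    requires a Riesz representation, built coefficient by coefficient. *)

Section RealNorm.
Context {R : realType} {X : normedModType R[i]}.
Implicit Types x y z : X.

(* The norm of a complex normed space takes values in [R[i]]. *)
Definition rnorm x : R := complex.Re `|x|.

Lemma rnormE x : `|x| = (rnorm x)%:C.
Proof. by rewrite /rnorm RRe_real // normr_real. Qed.

Lemma rnorm_ge0 x : 0 <= rnorm x.
Proof. by rewrite -lecR -rnormE normr_ge0. Qed.

Lemma rnorm0 : rnorm 0 = 0.
Proof. by rewrite /rnorm normr0. Qed.

Lemma rnormN x : rnorm (- x) = rnorm x.
Proof. by rewrite /rnorm normrN. Qed.

Lemma rnormD x y : rnorm (x + y) <= rnorm x + rnorm y.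
Proof. by rewrite -lecR rmorphD /= -!rnormE ler_normD. Qed.

Lemma rnorm_distC x y : rnorm (x - y) = rnorm (y - x).
Proof. by rewrite -rnormN opprB. Qed.

Lemma rnorm_distD z x y : rnorm (x - y) <= rnorm (x - z) + rnorm (z - y).
Proof. by apply: le_trans (rnormD _ _); rewrite addrA subrK. Qed.

Lemma rnormZ (c : R) x : rnorm (c%:C *: x) = `|c| * rnorm x.
Proof.
apply/(@complexI R); rewrite rmorphM /= -!rnormE normrZ; congr (_ * _).
by rewrite normcC /= expr0n /= addr0 sqrtr_sqr.
Qed.

Lemma nbhs_rnormP x (A : set X) :
  nbhs x A <-> exists2 e : R, 0 < e & forall y, rnorm (x - y) < e -> A y.
Proof.
split.
  move=> /nbhs_normP[e /= e0 eA].
  have eE : e = (complex.Re e)%:C by rewrite RRe_real // gtr0_real.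
  exists (complex.Re e); first by rewrite -ltcR -eE.
  by move=> y xy; apply: eA => /=; rewrite eE rnormE ltcR.
move=> [e e0 eA]; apply/nbhs_normP; exists e%:C => /=; first by rewrite ltcR.
by move=> y /=; rewrite rnormE ltcR; exact: eA.
Qed.

Lemma open_rnormP (A : set X) : open A <->
  forall x, A x -> exists2 e : R, 0 < e & forall y, rnorm (x - y) < e -> A y.
Proof.
by rewrite openE; split=> oA x Ax; [apply/nbhs_rnormP|apply/nbhs_rnormP]; apply: oA.
Qed.

Lemma open_rball x (e : R) : open [set y | rnorm (y - x) < e].
Proof.
apply/open_rnormP => y /= ye; exists (e - rnorm (y - x)); first by rewrite subr_gt0.
move=> z yz; have := rnorm_distD y z x; rewrite (rnorm_distC z y).
by move: yz; lra.
Qed.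

Definition rcauchy (u : nat -> X) := forall e : R, 0 < e ->
  exists N, forall m n, (N <= m)%N -> (N <= n)%N -> rnorm (u m - u n) < e.

Definition rcvg (u : nat -> X) l := forall e : R, 0 < e ->
  exists N, forall n, (N <= n)%N -> rnorm (u n - l) < e.

(** Nested closed balls: the ball of stage [n+1] lies in [F n] and in the open ball of stage [n].
    Completeness enters as a hypothesis on sequences, in the form that [H2_complete] provides. *)
Lemma rbaire (F : nat -> set X) :
  (forall u, rcauchy u -> exists l, rcvg u l) ->
  (forall n, open (F n) /\ dense (F n)) -> dense (\bigcap_n F n).
Proof.
move=> compl oF O [x0 Ox0] /open_rnormP oO.
have [r0 r00 Or0] := oO _ Ox0.
pose cb (p : X * R) := [set y | rnorm (y - p.1) <= p.2].
pose ob (p : X * R) := [set y | rnorm (y - p.1) < p.2].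
(* Positivity of the radius is assumed under the existential, so that [choice] yields a total
   function that can be iterated. *)
have step (q : nat * (X * R)) : exists p : X * R, 0 < q.2.2 ->
    [/\ 0 < p.2, p.2 <= q.1.+1%:R^-1, cb p `<=` ob q.2 & cb p `<=` F q.1].
  case: q => n [x r] /=.
  have [r1|?] := boolP (0 < r); last by exists (x, r).
  have [||y [xy Fy]] := (oF n).2 (ob (x, r)).
  - by exists x; rewrite /ob /= subrr rnorm0.
  - exact: open_rball.
  have /open_rnormP/(_ _ Fy)[e e0 eF] := (oF n).1.
  have/open_rnormP/(_ _ xy)[d d0 dO] := open_rball x r.
  (* Halving [e] and [d] turns inclusions of open balls into inclusions of closed ones; the first
     bound sends the radii to 0. *)
  exists (y, Num.min (n.+1%:R^-1) (Num.min (e / 2) (d / 2))) => _ /=; split.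
  - by rewrite !lt_min invr_gt0 ltr0n /= !divr_gt0.
  - by rewrite ge_min lexx.
  - move=> z; rewrite /cb /= !le_min => /and3P[_ _ zd]; apply: dO.
    by rewrite rnorm_distC; apply: le_lt_trans zd _; lra.
  - move=> z; rewrite /cb /= !le_min => /and3P[_ ze _]; apply: eF.
    by rewrite rnorm_distC; apply: le_lt_trans ze _; lra.
have [g Hg] := choice step.
pose fix s n := if n is m.+1 then g (m, s m) else (x0, r0).
have s0 n : 0 < (s n).2 by elim: n => [//|n /(Hg (n, s n))[]].
have sub n m : (n <= m)%N -> cb (s m) `<=` cb (s n).
  elim: m => [|m IH]; first by rewrite leqn0 => /eqP ->.
  rewrite leq_eqVlt => /predU1P[->//|/IH]; apply: subset_trans.
  have [_ _ H _] := Hg (m, s m) (s0 m).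
  by move=> y /H; exact: ltW.
have cbs n : cb (s n) (s n).1 by rewrite /cb /= subrr rnorm0 ltW.
have [|l Hl] := compl (fun n => (s n).1).
  move=> e e0.
  pose N := Num.truncn (2 / e).
  have HN : N.+1%:R^-1 < e / 2.
    rewrite -[e / 2]invrK ltf_pV2 ?posrE ?invr_gt0 ?divr_gt0 ?ltr0n //.
    by rewrite invf_div truncnS_gt.
  have rN : (s N.+1).2 <= N.+1%:R^-1 by case: (Hg (N, s N) (s0 N)).
  exists N.+1 => m n Nm Nn.
  have /= H1 := sub _ _ Nm _ (cbs m).
  have /= H2 := sub _ _ Nn _ (cbs n).
  have := rnorm_distD (s N.+1).1 (s m).1 (s n).1.
  rewrite (rnorm_distC (s N.+1).1).
  move: H1 H2 HN rN; rewrite /cb /=.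
  move: (g _).2 (N.+1%:R^-1) (rnorm _) (rnorm _) (rnorm _) => a b c d f; lra.
have lcb n : cb (s n) l.
  rewrite /cb /=; apply/ler_addgt0Pr => e e0.
  have [N /(_ (maxn N n))] := Hl _ e0; rewrite leq_maxl => /(_ isT) H.
  have := sub _ _ (leq_maxr N n) _ (cbs _); rewrite /cb /=.
  have := rnorm_distD (s (maxn N n)).1 l (s n).1.
  by rewrite rnorm_distC; move: H; rewrite rnorm_distC; lra.
exists l; split.
  have [_ _ /(_ _ (lcb 1%N)) H _] := Hg (0%N, s 0%N) (s0 0%N).
  by apply: Or0; rewrite rnorm_distC.
move=> n _.
by have [_ _ _ /(_ _ (lcb n.+1))] := Hg (n, s n) (s0 n).
Qed.

End RealNorm.

(** * Common hypercyclic vectors *)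

Section CommonHypercyclicity.
Context {R : realType} {X : normedModType R[i]}.
Variables (T S : {linear X -> X}).
Hypothesis T_contr : forall x, rnorm (T x) <= rnorm x.
Hypothesis S_isom : forall x, rnorm (S x) = rnorm x.
Hypothesis TS : cancel S T.
Hypothesis T_cvg0 : forall x (e : R), 0 < e ->
  exists n, rnorm (iter n T x) < e.

Lemma iter_raddf (A : {linear X -> X}) n : {morph iter n A : x y / x + y}.
Proof. by elim: n => [|n IH] x y //=; rewrite IH raddfD. Qed.

Lemma iter_linearZ (A : {linear X -> X}) n c : {morph iter n A : x / c *: x}.
Proof. by elim: n => [|n IH] x //=; rewrite IH linearZ. Qed.

Lemma iter_scale (c : R) n x :
  iter n (fun f => c%:C *: T f) x = (c ^+ n)%:C *: iter n T x.
Proof.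
elim: n => [|n IH]; first by rewrite expr0 scale1r.
by rewrite /= IH linearZ /= scalerA -rmorphM /= exprS.
Qed.

Lemma rnorm_iterT n x : rnorm (iter n T x) <= rnorm x.
Proof. by elim: n => //= n; apply: le_trans. Qed.

Lemma rnorm_iterS n x : rnorm (iter n S x) = rnorm x.
Proof. by elim: n => //= n <-. Qed.

Lemma iterTS n : cancel (iter n S) (iter n T).
Proof. by elim: n => // n IH x; rewrite iterSr /= TS. Qed.

Lemma iterT_le m n (x : X) (e : R) : (m <= n)%N ->
  rnorm (iter m T x) < e -> rnorm (iter n T x) < e.
Proof.
by move=> mn; apply: le_lt_trans; rewrite -(subnK mn) iterD rnorm_iterT.
Qed.

(** The claim holds for all large [n], so that one exponent can later serve two vectors at once. *)
Lemma kernel_dense x (e : R) : 0 < e -> exists N, forall n, (N <= n)%N ->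
  exists2 y, iter n T y = 0 & rnorm (y - x) < e.
Proof.
move=> e0; have [N HN] := T_cvg0 x _ e0; exists N => n Nn.
exists (x - iter n S (iter n T x)).
  have -> : - iter n S (iter n T x) = (-1) *: iter n S (iter n T x) by rewrite scaleN1r.
  by rewrite iter_raddf iter_linearZ iterTS scaleN1r subrr.
by rewrite addrAC subrr add0r rnormN rnorm_iterS; exact: iterT_le HN.
Qed.

(* The vector is built backwards: [v_k = l_k^(-(k+1)N) z + S^N v_(k+1)], so that
   [T^N v_k = v_(k+1)] because [T^N z = 0]. *)
Lemma approximation_chain (z : X) (N : nat) (a d : R) (l : nat -> R) :
  1 <= a -> 2 <= a ^+ N -> (forall k, a <= l k) -> (forall k, l k <= l k.+1) ->
  (forall k, (l k.+1 / l k) ^+ (k.+1 * N) <= 1 + d) -> iter N T z = 0 ->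
  forall m k, exists v,
  rnorm v <= 2 * (l k ^- (k.+1 * N)) * rnorm z /\
  forall i c, (i < m)%N -> l (k + i)%N <= c <= l (k + i).+1 ->
    rnorm ((c ^+ ((k + i).+1 * N))%:C *: iter (i * N) T v - z)
    <= (d + 2 / a ^+ N) * rnorm z.
Proof.
move=> a1 aN al lS ld zN.
have l0 k : 0 < l k by apply: lt_le_trans (al k); lra.
have a0 : 0 < a by lra.
elim=> [|m IH] k.
  exists 0; split=> [|//]; rewrite rnorm0 !mulr_ge0 ?rnorm_ge0 ?invr_ge0 ?exprn_ge0 //.
  exact: ltW.
have [v' [v'z Hv']] := IH k.+1.
exists ((l k ^- (k.+1 * N))%:C *: z + iter N S v'); split.
  apply: le_trans (rnormD _ _) _.
  rewrite rnormZ ger0_norm ?invr_ge0 ?exprn_ge0 ?(ltW (l0 k)) // rnorm_iterS.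
  rewrite -[2]/(1 + 1) mulrDl mul1r mulrDl. rewrite lerD2l.
  (* The tail [v'] must not exceed the bound on the head: passing from [k] to [k+1] brings an extra
     factor [l k.+1 ^+ N >= a ^+ N >= 2]. *)
  apply: le_trans v'z _; rewrite ler_wpM2r ?rnorm_ge0 //.
  have P0 : 0 < l k ^+ (k.+1 * N) by exact: exprn_gt0.
  have Q0 : 0 < l k.+1 ^+ (k.+2 * N) by exact: exprn_gt0.
  rewrite ler_pdivrMr // ler_pdivlMl // [leLHS]mulrC [X in _ <= l k.+1 ^+ X]mulSn exprD.
  apply: ler_pM => //; first by rewrite exprn_ge0 // ltW.
    by apply: le_trans aN _; rewrite lerXn2r ?nnegrE // ltW.
  by rewrite lerXn2r ?nnegrE // ltW.
case=> [|i] c.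
  (* With [n = (k+1) N] the error is [((c / l k) ^+ n - 1) z + c ^+ n S^N v']. The grid condition
     bounds the first term by [d * rnorm z]; [c <= l k.+1] and the bound on [v'] give
     [2 / a ^+ N * rnorm z] for the second. *)
  rewrite addn0 => _ /andP[lc cl]; rewrite mul0n /=.
  set n := (k.+1 * N)%N.
  have c0 : 0 < c by apply: lt_le_trans lc.
  rewrite scalerDr scalerA -rmorphM /= addrAC -[X in _ - X]scale1r -(rmorph1 (real_complex R)).
  rewrite -scalerBl -rmorphB /=; apply: le_trans (rnormD _ _) _.
  rewrite !rnormZ rnorm_iterS mulrDl -exprVn -exprMn; apply: lerD.
    rewrite ler_wpM2r ?rnorm_ge0 // ger0_norm.
      rewrite lerBlDl; apply: le_trans (ld k).
      by rewrite lerXn2r ?nnegrE ?divr_ge0 ?(ltW c0) ?(ltW (l0 _)) // ler_pM2r ?invr_gt0.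
    by rewrite subr_ge0 exprn_ege1 // ler_pdivlMr // mul1r.
  rewrite ger0_norm ?exprn_ge0 ?(ltW c0) //.
  apply: le_trans (ler_wpM2l _ v'z) _; first by rewrite exprn_ge0 // ltW.
  rewrite mulrA ler_wpM2r ?rnorm_ge0 // mulSn exprD -/n.
  have P0 : 0 < l k.+1 ^+ n by exact: exprn_gt0.
  have Q0 : 0 < l k.+1 ^+ N by exact: exprn_gt0.
  rewrite mulrCA ler_wpM2l // invfM mulrCA.
  rewrite -[leRHS]mulr1; apply: ler_pM.
  - by rewrite invr_ge0 ltW.
  - by rewrite divr_ge0 ?exprn_ge0 // ltW.
  - by rewrite lef_pV2 ?posrE ?exprn_gt0 // lerXn2r ?nnegrE // ltW.
  - by rewrite ler_pdivrMr // mul1r lerXn2r ?nnegrE // ltW.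
rewrite ltnS addnS => im; rewrite -addSn => Hc; have := Hv' i c im Hc.
rewrite (mulSn i) [(N + i * N)%N]addnC iterD iter_raddf iter_linearZ iterTS zN scaler0 add0r.
by [].
Qed.

(* The divergence of the harmonic series makes the steps reach any bound. *)
Lemma harmonic_grid (a d : R) (N : nat) : 0 < a -> 0 < d -> (0 < N)%N ->
  exists l : nat -> R, [/\ l 0%N = a, forall k, l k <= l k.+1,
    forall k, (l k.+1 / l k) ^+ (k.+1 * N) <= 1 + d &
    forall b, exists m, b <= l m].
Proof.
move=> a0 d0 N0.
have D0 : 0 < ln (1 + d) by rewrite ln_gt0 // ltrDl.
have N0' : 0 < N%:R :> R by rewrite ltr0n.
(* For [l k = a * expR (t * h k)] the ratio of neighbours is [expR (t / (k+1))], so this [t] makes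
   its power [(k+1) N] exactly [1 + d]. *)
pose t := ln (1 + d) / N%:R.
have t0 : 0 < t by rewrite divr_gt0.
pose h : nat -> R := series harmonic.
have hS k : h k.+1 = h k + k.+1%:R^-1 by rewrite /h seriesSr.
have hnd : nondecreasing_seq h.
  by apply/nondecreasing_seqP => k; rewrite hS lerDl invr_ge0 ler0n.
exists (fun k => a * expR (t * h k)); split.
- by rewrite /h seriesEnat /= big_geq // mulr0 expR0 mulr1.
- by move=> k; rewrite ler_pM2l // ler_expR ler_pM2l //; exact: hnd.
- move=> k; rewrite -mulf_div divff ?gt_eqF // mul1r -expRN -expRD -expRM_natl.
  have -> : (k.+1 * N)%:R * (t * h k.+1 - t * h k) = ln (1 + d).
    rewrite hS natrM /t; field.
    by rewrite nat1r !pnatr_eq0 -lt0n N0.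
  by rewrite lnK // posrE; lra.
- move=> b; apply: contrapT => /forallNP nb; apply: (@dvg_harmonic R).
  apply: nondecreasing_is_cvgn => //.
  (* If the grid stayed below [b], then [a * t * h k <= a * expR (t * h k) < b] would bound the
     harmonic sums. *)
  exists (b / (a * t)) => _ [k _ <-].
  have /negP := nb k; rewrite -ltNge => kb.
  rewrite -[series _ _]/(h k) ler_pdivlMr; last exact: mulr_gt0. rewrite [leLHS]mulrC -mulrA.
  apply: le_trans (ltW kb); rewrite ler_wpM2l ?(ltW a0) // mulrC.
  by apply: le_trans (expR_ge1Dx _); rewrite lerDr.
Qed.

Lemma grid_cell (l : nat -> R) m c : l 0%N <= c -> c <= l m.+1 ->
  exists2 i, (i <= m)%N & l i <= c <= l i.+1.
Proof.
move=> l0; elim: m => [|m IH] cm; first by exists 0%N; rewrite // l0.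
have [/IH[i im ic]|mc] := leP c (l m.+1); first by exists i => //; exact: leqW.
by exists m.+1; rewrite // ltW.
Qed.

(** The vector is the same for all [c] in [[a, b]]; only the time depends on [c], through the grid
    cell that contains it. *)
Lemma common_approximation (a b e : R) (y z : X) : 1 < a -> 0 < e ->
  exists2 x, rnorm (x - y) < e &
    forall c, a <= c <= b -> exists2 n, (1 <= n)%N &
      rnorm ((c ^+ n)%:C *: iter n T x - z) < e.
Proof.
move=> a1 e0; have e2 : 0 < e / 2 by lra.
have a0 : 0 < a by lra.
(* [Z] bounds the norm of the approximant [z'] chosen below, and is positive even when [z = 0]. *)
pose Z := rnorm z + e / 2.
have Z0 : 0 < Z by rewrite /Z; have := rnorm_ge0 z; lra.
pose d := e / (8 * Z).
have d0 : 0 < d by rewrite divr_gt0 // mulr_gt0.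
have dZ : d * Z = e / 8 by rewrite /d; field; rewrite gt_eqF.
(* From [a ^- N <= q] follow both [a ^+ N >= 2] and [2 / a ^+ N <= d]. The chain error is then at
   most [2 * d * Z = e / 4], and the norm of [v] at most [d * Z = e / 8]. *)
pose q := Num.min (2^-1) (d / 2).
have q0 : 0 < q by rewrite lt_min invr_gt0 ltr0n /= divr_gt0.
have [N1 HN1] : exists N1, forall n, (N1 <= n)%N -> a ^- n <= q.
  have /cvgrPdist_le/(_ _ q0)[N1 _ HN1] : (a^-1 ^+ n) @[n --> \oo] --> (0 : R).
    by apply: cvg_expr; rewrite ger0_norm ?invr_ge0 ?invf_lt1 // ltW.
  exists N1 => n /HN1 /=; rewrite sub0r normrN exprVn ger0_norm //.
  by rewrite invr_ge0 exprn_ge0 // ltW.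
have [N2 HN2] := kernel_dense y _ e2.
have [N3 HN3] := kernel_dense z _ e2.
pose N := (maxn N1 (maxn N2 N3)).+1.
have [y' y'0 y'y] : exists2 y', iter N T y' = 0 & rnorm (y' - y) < e / 2.
  by apply: HN2; rewrite /N leqW // !leq_max leqnn orbT.
have [z' z'0 z'z] : exists2 z', iter N T z' = 0 & rnorm (z' - z) < e / 2.
  by apply: HN3; rewrite /N leqW // !leq_max leqnn !orbT.
have z'Z : rnorm z' <= Z.
  rewrite -[z'](subrK z) /Z addrC; apply: le_trans (rnormD _ _) _.
  by rewrite lerD2l ltW.
have aq : a ^- N <= q by apply: HN1; rewrite /N leqW // leq_max leqnn.
have aN0 : 0 < a ^+ N by exact: exprn_gt0.
have aN2 : 2 <= a ^+ N.
  rewrite -lef_pV2 ?posrE //; apply: le_trans aq _.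
  by rewrite ge_min lexx.
have aNd : a ^- N <= d / 2 by apply: le_trans aq _; rewrite ge_min lexx orbT.
have [l [la lS ld lb]] := harmonic_grid a d N a0 d0 isT.
have [m bm] := lb b.
have al k : a <= l k.
  by elim: k => [|k]; [rewrite la|move=> /le_trans; apply].
have [v [vz Hv]] := approximation_chain z' N a d l (ltW a1) aN2 al lS ld z'0 m.+1 0%N.
have zd := rnorm_ge0 z'.
(* [T^N] kills [y'] and undoes [S^N], so at time [(i+1) N] only [T^(i N) v] remains, which is what
   the chain controls. *)
exists (y' + iter N S v).
  have : rnorm v < e / 2.
    apply: le_lt_trans vz _; rewrite la mul1n.
    apply: (@le_lt_trans _ _ (d * Z)); last by rewrite dZ; lra.
    apply: ler_pM => //; last by lra.
    by rewrite mulr_ge0 // invr_ge0 ltW.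
  have := rnormD (y' - y) (iter N S v); rewrite rnorm_iterS addrAC.
  by move: y'y; lra.
move=> c /andP[ac cb].
have [||i im ic] := grid_cell l m c.
- by rewrite la.
- exact: le_trans (le_trans cb bm) (lS _).
exists (i.+1 * N)%N; first by rewrite muln_gt0.
have := Hv i c; rewrite ltnS add0n => /(_ im ic).
rewrite mulSn addnC iterD iter_raddf y'0 add0r iterTS => H.
have := rnorm_distD z' ((c ^+ (i * N + N))%:C *: iter (i * N) T v) z.
have : (d + 2 / a ^+ N) * rnorm z' <= e / 4.
  apply: (@le_trans _ _ ((d + d) * Z)); last by rewrite mulrDl dZ; lra.
  have a2 : 0 < 2 / a ^+ N by exact: divr_gt0.
  by apply: ler_pM => //; lra.
by move: H z'z; lra.
Qed.

(** The exponent may vary with [c], but [x] may not: countably many of these sets are to replace the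
    intersection over all parameters. *)
Definition hits (a b r : R) (p : X) : set X :=
  [set x | forall c, a <= c <= b -> exists2 n, (1 <= n)%N &
    rnorm ((c ^+ n)%:C *: iter n T x - p) < r].

(** For a fixed exponent the condition is open jointly in [x] and [c]; compactness of [[a, b]] then
    gives one neighbourhood of [x] valid for all [c], as in the tube lemma. *)
Lemma open_hits a b r p : open (hits a b r p).
Proof.
apply/open_rnormP => x hx; apply/nbhs_rnormP.
have /compact_near_coveringP := @segment_compact R a b.
move=> /(_ X (nbhs x) (fun y c => exists2 n, (1 <= n)%N &
    rnorm ((c ^+ n)%:C *: iter n T y - p) < r)) H.
apply: filterS (H _ _).
  by move=> y yh c cab; apply: yh; rewrite /= in_itv.
move=> c; rewrite /= in_itv /= => cab.
have [n n1 cn] := hx c cab.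
pose d := r - rnorm ((c ^+ n)%:C *: iter n T x - p).
have d0 : 0 < d by rewrite subr_gt0.
(* The slack [d] is split between a change of parameter, weighted by [rnorm y <= M], and a change of
   vector, weighted by [K > |c ^+ n|]. The minimum with 1 taken below ensures [rnorm y <= M]. *)
pose M := rnorm x + 1.
have M0 : 0 < M by rewrite /M; have := rnorm_ge0 x; lra.
pose K := `|c ^+ n| + 1.
have K0 : 0 < K by rewrite ltr_wpDl.
have cX : (u ^+ n) @[u --> c] --> c ^+ n by exact: exprn_continuous.
have dM : 0 < d / (2 * M) by rewrite divr_gt0 // mulr_gt0.
have dK : 0 < Num.min 1 (d / (2 * K)) by rewrite lt_min ltr01 divr_gt0 // mulr_gt0.
exists ([set u | `|c ^+ n - u ^+ n| <= d / (2 * M)],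
  [set y | rnorm (x - y) < Num.min 1 (d / (2 * K))]).
  split => /=; first by move/cvgrPdist_le : cX; apply.
  by apply/nbhs_rnormP; exists (Num.min 1 (d / (2 * K))).
case=> u y [] /=; rewrite lt_min => cu /andP[xy1 xyd]; exists n => //.
have yM : rnorm y <= M.
  have := rnormD x (y - x); rewrite addrC subrK /M rnorm_distC.
  by move: xy1; lra.
have := rnorm_distD ((c ^+ n)%:C *: iter n T x) ((u ^+ n)%:C *: iter n T y) p.
have := rnorm_distD ((c ^+ n)%:C *: iter n T y) ((u ^+ n)%:C *: iter n T y)
  ((c ^+ n)%:C *: iter n T x).
rewrite -scalerBl -rmorphB /= -scalerBr !rnormZ.
have : `|u ^+ n - c ^+ n| * rnorm (iter n T y) <= d / 2.
  rewrite (_ : d / 2 = d / (2 * M) * M); last by field; rewrite gt_eqF.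
  rewrite distrC; apply: ler_pM => //; first exact: rnorm_ge0.
  by apply: le_trans yM; apply: rnorm_iterT.
have : `|c ^+ n| * rnorm (iter n T y - iter n T x) < d / 2.
  rewrite (_ : d / 2 = K * (d / (2 * K))); last by field; rewrite gt_eqF.
  apply: (@le_lt_trans _ _ (K * rnorm (x - y))); last by rewrite ltr_pM2l.
  rewrite -scaleN1r -iter_linearZ scaleN1r -iter_raddf rnorm_distC.
  rewrite ler_pM ?rnorm_ge0 //; first by rewrite /K lerDl.
  exact: rnorm_iterT.
by rewrite /d; lra.
Qed.

Lemma dense_hits a b r p : 1 < a -> 0 < r -> dense (hits a b r p).
Proof.
move=> a1 r0 O [y Oy] /open_rnormP/(_ _ Oy)[e e0 eO].
have er : 0 < Num.min e r by rewrite lt_min e0.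
have [x xy xh] := common_approximation a b _ y p a1 er.
exists x; split; first by apply: eO; rewrite rnorm_distC; move: xy; rewrite lt_min => /andP[].
by move=> c /xh[n n1]; rewrite lt_min => /andP[_ ?]; exists n.
Qed.

Theorem residual_common_hypercyclic (d : nat -> X) :
  (forall u : nat -> X, rcauchy u -> exists l, rcvg u l) ->
  (forall x (e : R), 0 < e -> exists n, rnorm (d n - x) < e) ->
  residual (\bigcap_(c in [set c : R | 1 < c])
    hypercyclic_vectors (fun x : X => c%:C *: T x)).
Proof.
move=> compl dd.
(* The intervals [[1 + 1/(m+1), m]] exhaust the parameters above 1, and the balls around [d j] of
   radius [1/(k+1)] test density. Indices that code no triple get the whole space. *)
pose F i : set X := if (unpickle i : option (nat * nat * nat)) is Some (m, j, k)
  then hits (1 + m.+1%:R^-1) m%:R (k.+1%:R^-1) (d j) else setT.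
have F_od i : open (F i) /\ dense (F i).
  rewrite /F; case: unpickle => [[[m j] k]|]; last first.
    by split; [exact: openT|move=> O [x Ox] _; exists x].
  split; first exact: open_hits.
  by apply: dense_hits; rewrite ?ltrDl invr_gt0 ltr0n.
suff -> : \bigcap_(c in [set c : R | 1 < c])
    hypercyclic_vectors (fun x : X => c%:C *: T x) = \bigcap_i F i.
  by split; [exact: rbaire|exists F => // i; case: (F_od i)].
apply/seteqP; split=> x hx.
  move=> i _; rewrite /F; case: unpickle => [[[m j] k]|//] c /andP[mc _].
  have c1 : 1 < c by apply: lt_le_trans mc; rewrite ltrDl invr_gt0 ltr0n.
  have [||y [yk [n n1 ny]]] := hx c c1 [set y | rnorm (y - d j) < k.+1%:R^-1].
  - by exists (d j); rewrite /= subrr rnorm0 invr_gt0 ltr0n.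
  - exact: open_rball.
  by exists n => //; rewrite -iter_scale ny.
move=> c /= c1 O [p Op] /open_rnormP/(_ _ Op)[e e0 eO].
have e2 : 0 < e / 2 by lra.
have [k ke] : exists k, k.+1%:R^-1 < e / 2.
  exists (Num.truncn (2 / e)).
  by rewrite -[e / 2]invrK ltf_pV2 ?posrE ?invr_gt0 // invf_div truncnS_gt.
have [j jp] := dd p _ e2.
(* The first entry puts the left end of the interval below [c], the second puts the right end above
   it. *)
pose m := maxn (Num.truncn ((c - 1)^-1)) (Num.truncn c).+1.
have m1 : 1 + m.+1%:R^-1 <= c.
  rewrite addrC -lerBrDr -[c - 1]invrK lef_pV2 ?posrE ?invr_gt0 ?subr_gt0 ?ltr0n //.
  apply: le_trans (ltW (truncnS_gt _)) _.
  by rewrite ler_nat ltnS leq_maxl.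
have m2 : c <= m%:R.
  by apply: le_trans (ltW (truncnS_gt _)) _; rewrite ler_nat leq_maxr.
have := hx (pickle (m, j, k)) I; rewrite /F pickleK => /(_ c).
rewrite m1 m2 => /(_ isT)[n n1] /= nk.
exists (iter n (fun f => c%:C *: T f) x); split; last by exists n.
apply: eO; rewrite iter_scale.
have := rnorm_distD (d j) p ((c ^+ n)%:C *: iter n T x).
rewrite (rnorm_distC (d j)) (rnorm_distC p (d j)).
by move: (lt_trans nk ke) jp; lra.
Qed.

End CommonHypercyclicity.

(** * Completeness and Hilbert structure of the Hardy space *)

Section ComplexConvergence.
Context {R : realType}.
Implicit Types z : R[i].

Lemma rnormc z : rnorm z = normc z.
Proof. by []. Qed.

Lemma Re_le_normc z : `|complex.Re z| <= normc z.
Proof. by case: z => x y /=; rewrite -sqrtr_sqr ler_wsqrtr // lerDl sqr_ge0. Qed.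

Lemma Im_le_normc z : `|complex.Im z| <= normc z.
Proof. by case: z => x y /=; rewrite -sqrtr_sqr ler_wsqrtr // lerDr sqr_ge0. Qed.

Lemma normc_real (x : R) : normc x%:C = `|x|.
Proof. by rewrite /= expr0n /= addr0 sqrtr_sqr. Qed.

Lemma normc_distC (x y : R[i]) : normc (x - y) = normc (y - x).
Proof. by rewrite -normc_opp opprB. Qed.

Lemma normcX z n : normc (z ^+ n) = normc z ^+ n.
Proof. by elim: n => [|n IH]; rewrite ?expr0 ?normc1 // !exprS normcM IH. Qed.

Lemma normc_sum (I : Type) (r : seq I) (F : I -> R[i]) :
  normc (\sum_(i <- r) F i) <= \sum_(i <- r) normc (F i).
Proof.
elim: r => [|i r IH]; first by rewrite !big_nil normc0.
by rewrite !big_cons; apply: le_trans (normc_triangle _ _) _; rewrite lerD2l.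
Qed.

(** Neighbourhoods in [X] are measured by elements of [R[i]]; this passage lets limits be handled
    with real epsilons. *)
Lemma cvg_rnormP {X : normedModType R[i]} {T : Type} (F : set_system T)
    {FF : Filter F} (f : T -> X) l :
  (f x @[x --> F] --> l) <-> (rnorm (f x - l) @[x --> F] --> (0 : R)).
Proof.
split=> [/cvgrPdist_lt fl|/cvgrPdist_lt fl].
  apply/cvgrPdist_lt => e e0.
  have := fl e%:C; rewrite ltcR => /(_ e0); apply: filterS => x.
  by rewrite rnormE ltcR sub0r normrN ger0_norm ?rnorm_ge0 // rnorm_distC.
apply/cvgrPdist_lt => e e0.
have eE : e = (complex.Re e)%:C by rewrite RRe_real // gtr0_real.
have := fl (complex.Re e); rewrite -ltcR -eE => /(_ e0); apply: filterS => x.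
by rewrite rnormE {2}eE ltcR sub0r normrN ger0_norm ?rnorm_ge0 // rnorm_distC.
Qed.

Lemma squeeze0 (f h : nat -> R) : (forall n, 0 <= f n <= h n) ->
  h @ \oo --> 0 -> f @ \oo --> 0.
Proof.
move=> fh h0; apply: (squeeze_cvgr (f := fun=> 0) _ _ h0); last exact: cvg_cst.
by apply: nearW => n; exact: fh.
Qed.

Lemma cvg_complex (u : nat -> R[i]) (a b : R) :
  complex.Re (u n) @[n --> \oo] --> a -> complex.Im (u n) @[n --> \oo] --> b ->
  u @ \oo --> (a +i* b).
Proof.
move=> ua ub; apply/cvg_rnormP.
apply: (@squeeze0 _ (fun n => `|complex.Re (u n) - a| + `|complex.Im (u n) - b|)).
  move=> n; rewrite rnorm_ge0 /=; case: (u n) => x y; rewrite rnormc.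
  rewrite [X in normc X]complexE (le_trans (normc_triangle _ _)) // normcM.
  by rewrite !normc_real /= expr0n expr1n add0r sqrtr1 mul1r.
rewrite -[0]addr0; apply: cvgD; rewrite -(normr0 R);
by apply: cvg_norm; apply/subr_cvg0.
Qed.

Lemma cvg_abs_series (u : nat -> R[i]) :
  cvgn (series (fun n => normc (u n))) -> cvgn (series u).
Proof.
move=> cu.
have aux (p : R[i] -> R) : (forall z, `|p z| <= normc z) ->
    {morph p : x y / x + y} -> p 0 = 0 ->
    p (series u n) @[n --> \oo] --> limn (series (p \o u)).
  move=> pn pD p0.
  have -> : (fun n => p (series u n)) = series (p \o u).
    apply/funext; elim=> [|n IH]; first by rewrite !seriesEnat /= !big_geq.
    by rewrite !seriesSr pD IH.
  apply: normed_cvg; apply: series_le_cvg cu => n; last exact: pn.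
    exact: normr_ge0.
  exact: normc_ge0.
apply/cvg_ex; eexists; apply: cvg_complex.
- by apply: aux => //; [exact: Re_le_normc|move=> [? ?] [? ?]].
- by apply: aux => //; [exact: Im_le_normc|move=> [? ?] [? ?]].
Qed.

Lemma complex_complete (u : nat -> R[i]) : rcauchy u -> exists l, rcvg u l.
Proof.
move=> cu.
have ReB : {morph @complex.Re R : x y / x - y} by move=> [? ?] [? ?].
have ImB : {morph @complex.Im R : x y / x - y} by move=> [? ?] [? ?].
have aux (p : R[i] -> R) : (forall z, `|p z| <= normc z) ->
    {morph p : x y / x - y} -> cvgn (p \o u).
  move=> pn pB; apply: cauchy_cvg; apply/cauchy_exP => e e0.
  have [N HN] := cu e e0; exists (p (u N)); exists N => // n /= Nn.
  rewrite -ball_normE /= -pB; apply: le_lt_trans (pn _) _.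
  exact: HN.
have /cvg_ex[a ua] := aux _ Re_le_normc ReB.
have /cvg_ex[b ub] := aux _ Im_le_normc ImB.
exists (a +i* b) => e e0.
have /cvg_rnormP/cvgrPdist_lt/(_ e e0)[N _ HN] := cvg_complex _ _ _ ua ub.
exists N => n /HN /=; by rewrite sub0r normrN ger0_norm // rnorm_ge0.
Qed.

End ComplexConvergence.

(** * Coefficients, truncations and point evaluation *)

Section HardyBasics.
Context {R : realType}.
Implicit Types (f g : H2 R) (a b : nat -> R[i]).

Lemma rnormH2 f : rnorm f = l2norm (taylor_coef f).
Proof. by []. Qed.

Lemma taylor_coef0 : taylor_coef (0 : H2 R) = fun=> 0.
Proof. by apply: taylor_coefE; exact: power_series0. Qed.

Lemma taylor_coefN f : taylor_coef (- f : H2 R) = fun n => - taylor_coef f n.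
Proof.
by rewrite -scaleN1r taylor_coefZ; apply/funext => n; rewrite mulN1r.
Qed.

Lemma taylor_coefB f g :
  taylor_coef (f - g : H2 R) = fun n => taylor_coef f n - taylor_coef g n.
Proof. by rewrite taylor_coefD taylor_coefN. Qed.

Lemma taylor_coef_sum (I : Type) (r : seq I) (F : I -> H2 R) n :
  taylor_coef (\sum_(i <- r) F i : H2 R) n = \sum_(i <- r) taylor_coef (F i) n.
Proof.
elim: r => [|i r IH]; first by rewrite !big_nil taylor_coef0.
by rewrite !big_cons taylor_coefD /= IH.
Qed.

Lemma taylor_coef_inj f g : taylor_coef f = taylor_coef g -> f = g.
Proof.
move=> fg; apply/eqP; rewrite -subr_eq0 -normr_eq0 rnormE rnormH2.
rewrite taylor_coefB fg (_ : (fun n => _) = taylor_coef (0 : H2 R)).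
  by rewrite -rnormH2 rnorm0.
by apply/funext => n; rewrite subrr taylor_coef0.
Qed.

Lemma sqsum_mono a b n : (forall k, (k < n)%N -> normc (a k) <= normc (b k)) ->
  sqsum a n <= sqsum b n.
Proof.
elim: n => [|n IH] ab; first by rewrite !sqsum0.
rewrite !sqsumS lerD //; first by apply: IH => k kn; apply: ab; exact: ltnW.
by rewrite lerXn2r ?nnegrE ?normc_ge0 // ab.
Qed.

Lemma sqsum_finite a N : (forall n, (N <= n)%N -> a n = 0) ->
  forall n, sqsum a n <= sqsum a N.
Proof.
move=> a0 n; have [nN|/ltnW/subnK<-] := leqP n N; first exact: sqsum_nd.
elim: (n - N)%N => [|m IH]; first by rewrite add0n.
rewrite addSn sqsumS a0 ?leq_addl //.
by rewrite normc0 expr0n addr0.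
Qed.

Lemma finite_square_summable a N : (forall n, (N <= n)%N -> a n = 0) ->
  square_summable a.
Proof.
move=> a0; apply: nondecreasing_is_cvgn; first exact: sqsum_nd.
by exists (sqsum a N) => _ [n _ <-]; exact: sqsum_finite.
Qed.

(** Comparing the l2 norm with the l1 norm turns estimates on finitely many coefficients into a norm
    estimate. *)
Lemma sqrt_sqsum_le a n : Num.sqrt (sqsum a n) <= \sum_(i < n) normc (a i).
Proof.
have S0 m : 0 <= \sum_(i < m) normc (a i) by apply: sumr_ge0 => i _; exact: normc_ge0.
elim: n => [|n IH]; first by rewrite sqsum0 sqrtr0 big_ord0.
rewrite -[leRHS]ger0_norm // -sqrtr_sqr ler_wsqrtr // sqsumS big_ord_recr /=.
have := IH; rewrite -[leRHS]ger0_norm // -sqrtr_sqr ler_sqrt ?sqr_ge0 //.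
have := normc_ge0 (a n); have := S0 n.
by move: (\sum_(i < n) _) (normc _) (sqsum _ _) => x y s; nra.
Qed.

Lemma coef_le_l2norm a n : square_summable a -> normc (a n) <= l2norm a.
Proof.
move=> ca; apply: le_trans (sqsum_le n.+1 ca).
rewrite -[normc _]ger0_norm ?normc_ge0 // -sqrtr_sqr ler_wsqrtr // sqsumS.
by rewrite lerDr sqsum_ge0.
Qed.

Lemma sqr_l2norm a : l2norm a ^+ 2 = limn (sqsum a).
Proof.
rewrite sqr_sqrtr //.
have [ca|ca] := pselect (square_summable a).
  by apply: limr_ge => //; apply: nearW => n; exact: sqsum_ge0.
by rewrite dvgP.
Qed.

Lemma geometric_cvg (M r : R) : 0 <= r < 1 ->
  series (fun n => M * r ^+ n) @ \oo --> M / (1 - r).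
Proof.
by move=> /andP[r0 r1]; apply: cvg_geometric_series; rewrite ger0_norm.
Qed.

Lemma abs_power_series a (M : R) z : (forall n, normc (a n) <= M) -> `|z| < 1 ->
  cvgn (series (fun n => normc (a n * z ^+ n))) /\
  forall n, series (fun n => normc (a n * z ^+ n)) n <= M / (1 - normc z).
Proof.
move=> aM; rewrite normcC ltcR => z1.
have z01 : 0 <= normc z < 1 by rewrite normc_ge0.
have M0 : 0 <= M by apply: le_trans (aM 0%N); exact: normc_ge0.
have le n : normc (a n * z ^+ n) <= M * normc z ^+ n.
  by rewrite normcM normcX ler_wpM2r // exprn_ge0 // normc_ge0.
have g0 n : 0 <= M * normc z ^+ n by rewrite mulr_ge0 ?exprn_ge0 ?normc_ge0.
have cg := geometric_cvg M _ z01.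
split.
  apply: (series_le_cvg _ _ le) => // [n|]; first exact: normc_ge0.
  by apply/cvg_ex; eexists; exact: cg.
move=> n; rewrite -(cvg_lim _ cg) //.
apply: (@le_trans _ _ (series (fun n => M * normc z ^+ n) n)).
  by rewrite !seriesEnat /= ler_sum.
apply: nondecreasing_cvgn_le; last by apply/cvg_ex; eexists; exact: cg.
by apply/nondecreasing_seqP => k; rewrite seriesSr lerDl.
Qed.

(** A square-summable sequence is bounded, so its power series converges on the disk. Elements of
    [H2] can therefore be built from their coefficients alone. *)
Lemma taylor_coef_surj a : square_summable a ->
  exists f : H2 R, taylor_coef f = a.
Proof.
move=> ca.
pose f (z : R[i]) : R[i] := if `|z| < 1 then limn (series (fun n => a n * z ^+ n)) else 0.
have fa : power_series_on_disk a f.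
  move=> z z1; rewrite /f z1.
  have [cz _] := abs_power_series a (l2norm a) z (fun n => coef_le_l2norm a n ca) z1.
  exact: cvg_abs_series cz.
have fH : f \in @hardy2 R.
  apply: mem_set; split; first by move=> z /negbTE z1; rewrite /f z1.
  by exists a.
by exists (MkH2 fH); rewrite (taylor_coefE fa).
Qed.

Definition of_coef a : H2 R := xget 0 [set f : H2 R | taylor_coef f = a].

Lemma of_coefK a : square_summable a -> taylor_coef (of_coef a) = a.
Proof.
move=> /taylor_coef_surj[f fa].
exact: (xgetPex 0 (ex_intro [set f : H2 R | taylor_coef f = a] f fa)).
Qed.

(** All coefficients are at most [rnorm f], and the rest is a geometric series. Cruder than
    Cauchy-Schwarz, but enough to deduce pointwise limits from norm limits. *)
Lemma eval_le f z : `|z| < 1 -> normc (f z) <= rnorm f / (1 - normc z).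
Proof.
move=> z1; have [fz cf] := H2_taylor f.
have [_ H] := abs_power_series _ _ z (fun n => coef_le_l2norm _ n cf) z1.
have /cvg_rnormP fz0 := fz z z1.
apply/ler_addgt0Pr => e e0.
have /cvgrPdist_lt/(_ e e0)[N _ /(_ N (leqnn _))] := fz0.
rewrite sub0r normrN ger0_norm ?rnorm_ge0 // rnormc normc_distC => He.
have := normc_triangle (f z - series (fun n => taylor_coef f n * z ^+ n) N)
  (series (fun n => taylor_coef f n * z ^+ n) N); rewrite subrK.
have := H N; rewrite -rnormH2.
have : normc (series (fun n => taylor_coef f n * z ^+ n) N) <=
   series (fun n => normc (taylor_coef f n * z ^+ n)) N.
  by rewrite !seriesEnat /=; exact: normc_sum.
by move: He; lra.
Qed.

Definition mono n : H2 R := of_coef (fun k => (k == n)%:R).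

Lemma taylor_coef_mono n k : taylor_coef (mono n) k = (k == n)%:R.
Proof.
rewrite of_coefK //; apply: (finite_square_summable _ n.+1) => m nm.
by rewrite gtn_eqF.
Qed.

Definition trunc f N : H2 R := \sum_(i < N) taylor_coef f i *: mono i.

Lemma taylor_coef_trunc f N k :
  taylor_coef (trunc f N) k = if (k < N)%N then taylor_coef f k else 0.
Proof.
rewrite taylor_coef_sum; under eq_bigr do rewrite taylor_coefZ taylor_coef_mono.
case: ifPn => kN.
  rewrite (bigD1 (Ordinal kN)) //= eqxx mulr1 big1 ?addr0 // => i /negbTE ik.
  by rewrite eq_sym -[_ == k]/(i == Ordinal kN) ik mulr0.
apply: big1 => i _; rewrite gtn_eqF ?mulr0 //.
by apply: leq_trans (ltn_ord i) _; rewrite leqNgt.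
Qed.

Lemma sqsum_tail a b n k : (forall j, b j = if (j < n)%N then 0 else a j) ->
  sqsum b (n + k) = sqsum a (n + k) - sqsum a n.
Proof.
move=> bE; elim: k => [|k IH]; last first.
  by rewrite addnS !sqsumS IH bE ltnNge leq_addr /= addrAC.
rewrite addn0 subrr; apply/le_anti; rewrite sqsum_ge0 andbT.
rewrite -(sqsum0 (fun=> 0)).
apply: le_trans (sqsum_finite (fun=> 0) 0%N _ n) => //.
by apply: sqsum_mono => j jn; rewrite bE jn.
Qed.

Lemma trunc_cvg f (e : R) : 0 < e ->
  exists N, forall n, (N <= n)%N -> rnorm (f - trunc f n : H2 R) < e.
Proof.
move=> e0; have [_ cf] := H2_taylor f.
set a := taylor_coef f in cf *.
have /cvgrPdist_lt/(_ _ (exprn_gt0 2 e0))[N _ HN] := cf.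
exists N => n /HN /= {}HN.
have an : sqsum a n <= limn (sqsum a) by exact: nondecreasing_cvgn_le (sqsum_nd a) cf n.
have e' : limn (sqsum a) - sqsum a n < e ^+ 2.
  by move: HN; rewrite ger0_norm ?subr_ge0.
rewrite rnormH2; apply: (@le_lt_trans _ _ (Num.sqrt (limn (sqsum a) - sqsum a n))).
  apply: (sqsum_bound _ _).2; first exact: sqrtr_ge0.
  move=> k; rewrite ler_wsqrtr //.
  have tE j : taylor_coef (f - trunc f n : H2 R) j = if (j < n)%N then 0 else a j.
    by rewrite taylor_coefB taylor_coef_trunc; case: ifP; rewrite ?subrr ?subr0.
  move: (taylor_coef _) tE => b bE.
  apply: (@le_trans _ _ (sqsum b (n + k))).
    by apply: sqsum_nd; rewrite leq_addl.
  rewrite (sqsum_tail a _ n k bE).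
  by rewrite lerB //; exact: nondecreasing_cvgn_le (sqsum_nd a) cf _.
rewrite -[e]ger0_norm ?ltW // -sqrtr_sqr ltr_sqrt //.
by rewrite exprn_gt0.
Qed.

End HardyBasics.

(** * Completeness, separability and the inner product *)

Section HardyHilbert.
Context {R : realType}.
Implicit Types (f g h : H2 R) (a b : nat -> R[i]).

Lemma coef_le_rnorm f n : normc (taylor_coef f n) <= rnorm f.
Proof. exact: coef_le_l2norm (H2_taylor f).2. Qed.

Lemma H2_complete (u : nat -> H2 R) : rcauchy u -> exists l, rcvg u l.
Proof.
move=> cu.
pose c n := taylor_coef (u n).
have cB m n : taylor_coef (u m - u n : H2 R) = fun k => c m k - c n k.
  exact: taylor_coefB.
have /choice[a ac] : forall k, exists l : R[i], rcvg (fun n => c n k) l.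
  move=> k; apply: complex_complete => e /cu[N HN]; exists N => m n Nm Nn.
  apply: le_lt_trans (HN m n Nm Nn); rewrite rnormc.
  by have := coef_le_rnorm (u m - u n) k; rewrite cB.
have ac0 K : (\sum_(k < K) normc (a k - c m k)) @[m --> \oo] --> (0 : R).
  elim: K => [|K IH].
    by under eq_fun do rewrite big_ord0; exact: cvg_cst.
  under eq_fun do rewrite big_ord_recr /=.
  have aK : normc (a K - c m K) @[m --> \oo] --> (0 : R).
    apply/cvgrPdist_lt => e /(ac K)[N HN]; exists N => // n /HN.
    by rewrite sub0r normrN ger0_norm ?normc_ge0 // normc_distC.
  rewrite -[X in nbhs X](addr0 (0 : R)); exact: cvgD.
have bound (e : R) : 0 < e -> exists N, forall n, (N <= n)%N ->
    square_summable (fun k => a k - c n k) /\ l2norm (fun k => a k - c n k) <= e.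
  move=> e0; have [N HN] := cu e e0; exists N => n Nn.
  apply: sqsum_bound (ltW e0) _ => K; apply/ler_addgt0Pr => d d0.
  have /cvgrPdist_lt/(_ d d0)[M _ HM] := ac0 K.
  (* The intermediate index depends on the section length [K], but the resulting bound [e] does not,
     so it passes to the whole sequence. *)
  have := HM (maxn M N) (leq_maxl _ _); rewrite /= sub0r normrN.
  set m := maxn M N => Hm.
  have -> : (fun k => a k - c n k) = (fun k => a k - c m k) \+ (fun k => c m k - c n k).
    by apply/funext => k /=; rewrite addrA subrK.
  apply: le_trans (sqsumD _ _ _) _; rewrite addrC; apply: lerD.
    apply: le_trans (ltW (HN m n (leq_maxr _ _) Nn)).
    rewrite rnormH2 -cB; exact: sqsum_le (H2_taylor _).2.
  apply: le_trans (sqrt_sqsum_le _ _) _; apply: le_trans (ltW Hm).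
  exact: ler_norm.
have [N /(_ N (leqnn _))[aN _]] := bound 1 ltr01.
have ca : square_summable a.
  rewrite (_ : a = (fun k => a k - c N k) \+ c N).
    exact: (l2normD aN (H2_taylor _).2).1.
  by apply/funext => k /=; rewrite subrK.
have [l la] := taylor_coef_surj a ca.
exists l => e e0; have e2 : 0 < e / 2 by lra.
have [M HM] := bound _ e2; exists M => n /HM[_].
rewrite rnorm_distC rnormH2 taylor_coefB la -/(c n).
by move=> /le_lt_trans; apply; lra.
Qed.

Lemma ratr_approx (x e : R) : 0 < e -> exists q : rat, `|x - ratr q| < e.
Proof.
move=> e0; have [|q] := @rat_in_itvoo R (x - e) (x + e); first by lra.
rewrite in_itv /= => /andP[q1 q2]; exists q.
by rewrite ltr_norml; apply/andP; split; lra.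
Qed.

Lemma H2_separable : exists d : nat -> H2 R,
  forall f (e : R), 0 < e -> exists n, rnorm (d n - f) < e.
Proof.
pose cplx (q : rat * rat) : R[i] := ratr q.1 +i* ratr q.2.
pose D (s : seq (rat * rat)) : H2 R :=
  of_coef (fun i => if (i < size s)%N then cplx (nth (0, 0) s i) else 0).
have coefD s : taylor_coef (D s) =
    fun i => if (i < size s)%N then cplx (nth (0, 0) s i) else 0.
  rewrite of_coefK //; apply: (finite_square_summable _ (size s)) => n.
  by rewrite leqNgt => /negbTE ->.
exists (fun n => if unpickle n is Some s then D s else 0) => f e e0.
have e2 : 0 < e / 2 by lra.
have [N /(_ N (leqnn _)) fN] := trunc_cvg f _ e2.
(* Each of the [N] coefficients costs a real and an imaginary error, hence 4 where 2 is wanted in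
   total; [N.+1] avoids a division by 0. *)
have dd : 0 < e / 4 / N.+1%:R by rewrite !divr_gt0.
have /choice[q Hq] : forall k, exists q : rat * rat,
    normc (cplx q - taylor_coef f k) < e / 2 / N.+1%:R.
  move=> k.
  have [q1 H1] := ratr_approx (complex.Re (taylor_coef f k)) _ dd.
  have [q2 H2] := ratr_approx (complex.Im (taylor_coef f k)) _ dd.
  exists (q1, q2); rewrite normc_distC /cplx.
  move: H1 H2; case: (taylor_coef f k) => x y H1 H2.
  rewrite /= in H1 H2.
  rewrite [X in normc X]complexE (le_lt_trans (normc_triangle _ _)) // normcM.
  rewrite !normc_real /= expr0n expr1n add0r sqrtr1 mul1r.
  have -> : e / 2 / N.+1%:R = e / 4 / N.+1%:R + e / 4 / N.+1%:R.
    by rewrite -mulrDl; congr (_ / _); lra.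
  exact: ltrD.
exists (pickle (mkseq q N)); rewrite pickleK.
apply: le_lt_trans (rnorm_distD (trunc f N) _ _) _.
rewrite (rnorm_distC _ f) [ltRHS]splitr; apply: ler_ltD fN.
rewrite rnormH2 taylor_coefB coefD size_mkseq.
apply: (sqsum_bound _ _).2; first exact: ltW.
move=> n; apply: (@le_trans _ _ (Num.sqrt (sqsum (fun k =>
    (if (k < N)%N then cplx (nth (0, 0) (mkseq q N) k) else 0) -
     taylor_coef (trunc f N) k) N))).
  rewrite ler_wsqrtr //; apply: sqsum_finite => k.
  by rewrite taylor_coef_trunc leqNgt => /negbTE ->; rewrite subrr.
apply: le_trans (sqrt_sqsum_le _ _) _.
apply: (@le_trans _ _ (\sum_(i < N) (e / 2 / N.+1%:R))).
  apply: ler_sum => i _; rewrite taylor_coef_trunc ltn_ord nth_mkseq //.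
  exact: ltW.
rewrite sumr_const card_ord -[leLHS]mulr_natr mulrAC -(mulrA (e / 2)).
rewrite ler_piMr ?(ltW e2) //.
by rewrite ler_pdivrMr ?ltr0n // mul1r ler_nat.
Qed.

Lemma normc_conj (z : R[i]) : normc z^* = normc z.
Proof. by apply/complexI; rewrite -!normcC norm_conjC. Qed.

(** Cauchy-Schwarz by induction: the inductive step reduces to [0 <= (A * y - B * x) ^+ 2]. *)
Lemma sum_normc_le a b n : \sum_(i < n) normc (a i * (b i)^*) <=
  Num.sqrt (sqsum a n) * Num.sqrt (sqsum b n).
Proof.
elim: n => [|n IH]; first by rewrite !sqsum0 big_ord0 sqrtr0 mul0r.
rewrite big_ord_recr /= !sqsumS -sqrtrM ?addr_ge0 ?sqsum_ge0 ?sqr_ge0 //.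
apply: (@le_trans _ _ (Num.sqrt (sqsum a n) * Num.sqrt (sqsum b n) +
  normc (a n * (b n)^*))); first by rewrite lerD2r.
rewrite normcM normc_conj.
have := sqr_sqrtr (sqsum_ge0 a n); have := sqr_sqrtr (sqsum_ge0 b n).
have := sqrtr_ge0 (sqsum a n); have := sqrtr_ge0 (sqsum b n).
have := normc_ge0 (a n); have := normc_ge0 (b n).
move: (Num.sqrt _) (Num.sqrt _) (normc _) (normc _) => B A y x y0 x0 B0 A0 <- <-.
rewrite -[leLHS]ger0_norm ?addr_ge0 ?mulr_ge0 // -sqrtr_sqr ler_wsqrtr //.
rewrite -subr_ge0 [leRHS](_ : _ = (A * y - B * x) ^+ 2); last by ring.
exact: sqr_ge0.
Qed.

Definition inner_terms f g n := taylor_coef f n * (taylor_coef g n)^*.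

Lemma sum_inner_terms_le f g n :
  \sum_(i < n) normc (inner_terms f g i) <= rnorm f * rnorm g.
Proof.
apply: le_trans (sum_normc_le _ _ _) _.
by apply: ler_pM; rewrite ?sqrtr_ge0 //; exact: sqsum_le (H2_taylor _).2.
Qed.

Lemma inner_cvg f g : series (inner_terms f g) @ \oo --> H2_inner f g.
Proof.
apply: cvg_abs_series; apply: nondecreasing_is_cvgn.
  by apply/nondecreasing_seqP => n; rewrite seriesSr lerDl normc_ge0.
exists (rnorm f * rnorm g) => _ [n _ <-]; rewrite seriesEord /=.
exact: sum_inner_terms_le.
Qed.

Lemma inner_le f g : normc (H2_inner f g) <= rnorm f * rnorm g.
Proof.
apply/ler_addgt0Pr => e e0.
have /cvg_rnormP/cvgrPdist_lt/(_ e e0)[N _ /(_ N (leqnn _))] := inner_cvg f g.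
rewrite sub0r normrN ger0_norm ?rnorm_ge0 // rnormc normc_distC => He.
rewrite -(subrK (series (inner_terms f g) N) (H2_inner f g)) [leRHS]addrC.
apply: le_trans (normc_triangle _ _) (lerD (ltW He) _).
rewrite seriesEord /=; apply: le_trans (normc_sum _ _ _) _.
exact: sum_inner_terms_le.
Qed.

Lemma seriesDZ (l : R[i]) (u v : nat -> R[i]) (x y : R[i]) :
  series u @ \oo --> x -> series v @ \oo --> y ->
  series (fun n => l * u n + v n) @ \oo --> l * x + y.
Proof.
move=> ux vy.
have -> : series (fun n => l * u n + v n) = (fun n => l * series u n + series v n).
  by apply/funext => n; rewrite !seriesEord /= mulr_sumr -big_split.
apply: cvgD; last exact: vy.
by apply: (@cvgMl_tmp R[i] nat \oo _ _ l x); exact: ux.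
Qed.

Lemma cvgc_unique (u : nat -> R[i]) (x y : R[i]) : u @ \oo --> x -> u @ \oo --> y -> x = y.
Proof. by move=> ux; apply: cvg_unique ux; exact: norm_hausdorff. Qed.

Lemma inner_linear_l l f h g :
  H2_inner (l *: f + h) g = l * H2_inner f g + H2_inner h g.
Proof.
apply: cvgc_unique (inner_cvg _ _) _.
rewrite (_ : inner_terms _ _ = fun n => l * inner_terms f g n + inner_terms h g n).
  by apply: seriesDZ; exact: inner_cvg.
apply/funext => n; rewrite /inner_terms taylor_coefD /= taylor_coefZ.
by rewrite mulrDl mulrA.
Qed.

Lemma inner_linear_r l f g h :
  H2_inner f (l *: g + h) = l^* * H2_inner f g + H2_inner f h.
Proof.
apply: cvgc_unique (inner_cvg _ _) _.
rewrite (_ : inner_terms _ _ = fun n => l^* * inner_terms f g n + inner_terms f h n).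
  by apply: seriesDZ; exact: inner_cvg.
apply/funext => n; rewrite /inner_terms taylor_coefD /= taylor_coefZ.
by rewrite rmorphD rmorphM mulrDr mulrCA.
Qed.

Lemma inner_self f : H2_inner f f = (rnorm f ^+ 2)%:C.
Proof.
apply: cvgc_unique (inner_cvg _ _) _.
rewrite (_ : series _ = fun n => (sqsum (taylor_coef f) n)%:C).
  apply/cvg_rnormP; under eq_fun do rewrite -rmorphB /= rnormc normc_real.
  rewrite -(normr0 R); apply: cvg_norm; apply/subr_cvg0.
  by rewrite rnormH2 sqr_l2norm; exact: (H2_taylor f).2.
apply/funext; elim=> [|n IH]; first by rewrite sqsum0 seriesEnat /= big_geq.
by rewrite sqsumS seriesSr IH rmorphD /= rmorphXn /inner_terms -normCK normcC.
Qed.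

Lemma cvg_series_single (u : nat -> R[i]) n : (forall k, k != n -> u k = 0) ->
  series u @ \oo --> u n.
Proof.
move=> u0; rewrite -(@cvg_shiftn n.+1); apply: cvg_near_cst.
apply: nearW => k; rewrite seriesEord /=.
have nk : (n < k + n.+1)%N by rewrite addnS ltnS leq_addl.
by rewrite (bigD1 (Ordinal nk)) //= big1 ?addr0 // => i ik; apply: u0.
Qed.

Lemma inner_mono_l g n : H2_inner (mono n) g = (taylor_coef g n)^*.
Proof.
apply: cvgc_unique (inner_cvg _ _) _.
have -> : (taylor_coef g n)^* = inner_terms (mono n) g n.
  by rewrite /inner_terms taylor_coef_mono eqxx mul1r.
apply: cvg_series_single => k /negbTE kn.
by rewrite /inner_terms taylor_coef_mono kn mul0r.
Qed.

Lemma inner_mono_r f n : H2_inner f (mono n) = taylor_coef f n.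
Proof.
apply: cvgc_unique (inner_cvg _ _) _.
have -> : taylor_coef f n = inner_terms f (mono n) n.
  by rewrite /inner_terms taylor_coef_mono eqxx rmorph1 mulr1.
apply: cvg_series_single => k /negbTE kn.
by rewrite /inner_terms taylor_coef_mono kn rmorph0 mulr0.
Qed.

Lemma conj_inj (x y : R[i]) : x^* = y^* -> x = y.
Proof. by move=> xy; rewrite -(conjCK x) xy conjCK. Qed.

Lemma inner_inj g h : (forall f, H2_inner f g = H2_inner f h) -> g = h.
Proof.
move=> gh; apply: taylor_coef_inj; apply/funext => n.
have := gh (mono n); rewrite (inner_mono_l g n) (inner_mono_l h n).
exact: conj_inj.
Qed.

End HardyHilbert.

(** * Adjoints of isometries *)

Section IsometryAdjoint.
Context {R : realType}.
Implicit Types f g h : H2 R.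

Lemma inner0l g : H2_inner 0 g = 0.
Proof.
apply: (addIr (H2_inner 0 g)); rewrite add0r.
by have := inner_linear_l 1 0 0 g; rewrite scale1r add0r mul1r.
Qed.

Lemma inner0r f : H2_inner f 0 = 0.
Proof.
apply: (addIr (H2_inner f 0)); rewrite add0r.
by have := inner_linear_r 1 f 0 0; rewrite scale1r add0r rmorph1 mul1r.
Qed.

Lemma innerZl l f g : H2_inner (l *: f) g = l * H2_inner f g.
Proof. by have := inner_linear_l l f 0 g; rewrite inner0l !addr0. Qed.

Lemma innerZr l f g : H2_inner f (l *: g) = l^* * H2_inner f g.
Proof. by have := inner_linear_r l f g 0; rewrite inner0r !addr0. Qed.

Lemma innerDl f h g : H2_inner (f + h) g = H2_inner f g + H2_inner h g.
Proof. by have := inner_linear_l 1 f h g; rewrite scale1r mul1r. Qed.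

Lemma innerDr f g h : H2_inner f (g + h) = H2_inner f g + H2_inner f h.
Proof. by have := inner_linear_r 1 f g h; rewrite scale1r rmorph1 mul1r. Qed.

Lemma cancel_diag (a b p p' q q' : R[i]) :
  a + p + (p' + b) = a + q + (q' + b) -> p + p' = q + q'.
Proof. by move=> e; apply: (addrI a); apply: (addIr b); rewrite !addrA in e *. Qed.

(** Complex polarization in scalar form: the pair [f, g] gives the sum of the two cross products,
    the pair [f, 'i *: g] their difference, and together they determine each one. *)
Lemma cancel_skew (p p' q q' : R[i]) : p + p' = q + q' ->
  'i^* * p + 'i * p' = 'i^* * q + 'i * q' -> p = q.
Proof.
rewrite conjCi !mulNr ![- _ + _]addrC -!mulrBr => e1 /(mulfI (neq0Ci _)) e2.
apply/eqP; rewrite -subr_eq0; apply/eqP.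
have : (p - q) *+ 2 = (p + p') - (p' - p) - ((q + q') - (q' - q)) by ring.
by rewrite e1 e2 subrr => /eqP; rewrite mulrn_eq0 /= => /eqP.
Qed.

Variable S : {linear H2 R -> H2 R}.
Hypothesis S_isom : forall f, rnorm (S f) = rnorm f.

(* Polarization: [<S f, S g> - <f, g>] is sesquilinear and vanishes on the
   diagonal. *)
Lemma isometry_inner f g : H2_inner (S f) (S g) = H2_inner f g.
Proof.
have diag h : H2_inner (S h) (S h) = H2_inner h h by rewrite !inner_self S_isom.
have key h k : H2_inner (S h) (S k) + H2_inner (S k) (S h) =
    H2_inner h k + H2_inner k h.
  have := diag (h + k); rewrite linearD !innerDl !innerDr !diag.
  exact: cancel_diag.
have := key f ('i *: g); have := key f g; rewrite linearZ !innerZl !innerZr.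
exact: cancel_skew.
Qed.

Lemma trunc_linear f N g :
  H2_inner (S (trunc f N)) g =
  \sum_(i < N) taylor_coef f i * H2_inner (S (mono i)) g.
Proof.
elim: N => [|N IH]; first by rewrite /trunc !big_ord0 linear0 inner0l.
by rewrite /trunc !big_ord_recr /= linearD linearZ innerDl innerZl IH.
Qed.

(** Riesz representation: testing on monomials forces the coefficients [b] of [h]. To see that [b]
    is square-summable, its own sections are used as test functions; density of truncations then
    gives the identity for every [f]. *)
Lemma adjoint_exists g : exists h, forall f, H2_inner (S f) g = H2_inner f h.
Proof.
pose b n := (H2_inner (S (mono n)) g)^*.
have [cb _] : square_summable b /\ l2norm b <= rnorm g.
  apply: sqsum_bound; first exact: rnorm_ge0.
  move=> n; pose h := of_coef (fun k => if (k < n)%N then b k else 0).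
  have ch : taylor_coef h = fun k => if (k < n)%N then b k else 0.
    rewrite of_coefK //; apply: (finite_square_summable _ n) => k.
    by rewrite leqNgt => /negbTE ->.
  have tr : trunc h n = h.
    apply: taylor_coef_inj; apply/funext => k; rewrite taylor_coef_trunc ch.
    by case: (k < n)%N.
  have hb : sqsum b n = sqsum (taylor_coef h) n.
    apply/le_anti; rewrite ch; apply/andP; split; apply: sqsum_mono => k kn;
    by rewrite kn.
  have hn : rnorm h <= Num.sqrt (sqsum b n).
    rewrite rnormH2; apply: (sqsum_bound _ _).2; first exact: sqrtr_ge0.
    move=> m; rewrite ler_wsqrtr // hb; apply: sqsum_finite => k nk.
    by rewrite ch ltnNge nk.
  have E : H2_inner (S h) g = (sqsum b n)%:C.
    rewrite -tr trunc_linear /sqsum seriesEord /= rmorph_sum /=.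
    apply: eq_bigr => i _; rewrite ch ltn_ord rmorphXn /= -normcC normCK.
    by rewrite /b conjCK.
  (* With [s] the norm of the section this reads [s ^+ 2 <= s * rnorm g]; the case [s = 0] is split
     off before dividing. *)
  have := inner_le (S h) g; rewrite E normc_real ger0_norm ?sqsum_ge0 // S_isom.
  move=> /le_trans/(_ (ler_wpM2r (rnorm_ge0 g) hn)).
  rewrite -{1}(sqr_sqrtr (sqsum_ge0 b n)).
  have := sqrtr_ge0 (sqsum b n); move: (Num.sqrt _) => s.
  rewrite le_eqVlt => /predU1P[<- _|s0]; first exact: rnorm_ge0.
  by rewrite expr2 ler_pM2l.
have [h hE] := taylor_coef_surj b cb.
exists h => f; apply: cvgc_unique (inner_cvg f h).
have -> : series (inner_terms f h) = fun N => H2_inner (S (trunc f N)) g.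
  apply/funext => N; rewrite trunc_linear seriesEord /=; apply: eq_bigr => i _.
  by rewrite /inner_terms hE /b conjCK.
apply/cvg_rnormP/cvgrPdist_lt => e e0.
have g0 := rnorm_ge0 g; have g1 : 0 < rnorm g + 1 by lra.
have [N HN] := trunc_cvg f (e / (rnorm g + 1)) (divr_gt0 e0 g1).
exists N => // n /HN fn /=; rewrite sub0r normrN ger0_norm ?rnorm_ge0 //.
have -> : H2_inner (S (trunc f n)) g - H2_inner (S f) g =
    - H2_inner (S (f - trunc f n)) g.
  by rewrite linearB innerDl -(scaleN1r (S (trunc f n))) innerZl mulN1r opprB.
rewrite rnormN rnormc; apply: le_lt_trans (inner_le _ _) _; rewrite S_isom.
apply: (@le_lt_trans _ _ (rnorm (f - trunc f n : H2 R) * (rnorm g + 1))).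
  by rewrite ler_wpM2l ?rnorm_ge0 // lerDl.
by rewrite -ltr_pdivlMr.
Qed.

Lemma adjointP f g : H2_inner (S f) g = H2_inner f (H2_adjoint S g).
Proof.
have [h hP] := adjoint_exists g.
exact: (xgetPex 0 (ex_intro [set h : H2 R | forall f, H2_inner (S f) g = H2_inner f h] h hP)).
Qed.

Lemma adjoint_linear : linear (H2_adjoint S).
Proof.
move=> l g h; apply: inner_inj => f.
have := adjointP f (l *: g + h); rewrite inner_linear_r (adjointP f g) (adjointP f h) => <-.
by rewrite inner_linear_r.
Qed.

(** For [h] the adjoint at [g], the square of [rnorm h] is the inner product of [S h] with [g],
    hence at most [rnorm h * rnorm g]. *)
Lemma adjoint_contraction g : rnorm (H2_adjoint S g) <= rnorm g.
Proof.
have := inner_self (H2_adjoint S g); rewrite -adjointP => E.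
have := inner_le (S (H2_adjoint S g)) g; rewrite E normc_real S_isom.
have := rnorm_ge0 (H2_adjoint S g); have := rnorm_ge0 g.
move: (rnorm (H2_adjoint S g)) (rnorm g) => s t t0; rewrite le_eqVlt.
move=> /predU1P[<- _|s0]; first exact: t0.
by rewrite ger0_norm ?sqr_ge0 // expr2 ler_pM2l.
Qed.

Lemma adjoint_isometryK : cancel S (H2_adjoint S).
Proof. by move=> g; apply: inner_inj => f; rewrite -adjointP isometry_inner. Qed.

Lemma taylor_coef_adjoint g n :
  (taylor_coef (H2_adjoint S g) n)^* = H2_inner (S (mono n)) g.
Proof. by rewrite -inner_mono_l adjointP. Qed.

End IsometryAdjoint.

Lemma cvg0_geometric_error {R : realType} (q : R) (x eps : nat -> R) :
  0 <= q < 1 -> (forall n, 0 <= x n) ->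
  (forall n, x n.+1 <= q * x n + eps n) -> eps @ \oo --> 0 -> x @ \oo --> 0.
Proof.
move=> /andP[q0 q1] x0 xS /cvgrPdist_lt eps0; apply/cvgrPdist_lt => e e0.
(* With this error level, [e / 2] is the fixed point of the affine recursion, so the excess over it
   shrinks like [q ^+ m]. *)
have d0 : 0 < (1 - q) * (e / 2) by rewrite mulr_gt0 ?divr_gt0 // subr_gt0.
have [N _ HN] := eps0 _ d0.
have epsN m : eps (m + N)%N <= (1 - q) * (e / 2).
  have := HN (m + N)%N (leq_addl _ _); rewrite /= sub0r normrN => /ltW.
  exact: le_trans (ler_norm _).
have xN m : x (m + N)%N <= q ^+ m * x N + e / 2.
  elim: m => [|m IH]; first by rewrite add0n expr0 mul1r lerDl ltW // divr_gt0.
  rewrite addSn; apply: le_trans (xS _) _.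
  apply: le_trans (lerD (ler_wpM2l q0 IH) (epsN m)) _.
  rewrite exprS mulrDr mulrBl mul1r -mulrA.
  by move: (q * (q ^+ m * _)) (q * (e / 2)) => u v; lra.
have xN0 : 0 < x N + 1 by have := x0 N; lra.
have /cvgrPdist_lt/(_ (e / 2 / (x N + 1)))[] : (q ^+ m) @[m --> \oo] --> (0 : R).
- by apply: cvg_expr; rewrite ger0_norm.
- by rewrite !divr_gt0.
move=> M _ HM; exists (M + N)%N => // n /= Mn.
have Nn : (N <= n)%N by apply: leq_trans Mn; rewrite leq_addl.
rewrite sub0r normrN ger0_norm // -(subnK Nn).
have /HM /= : (M <= n - N)%N by rewrite leq_subRL // addnC.
rewrite sub0r normrN ger0_norm ?exprn_ge0 // ltr_pdivlMr // => Hq.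
have := xN (n - N)%N; have := exprn_ge0 (n - N)%N q0; have := x0 N.
move: Hq; move: (x (_ + _)%N) (q ^+ _) (x N) => a b c; nra.
Qed.

Lemma rnormZc {R : realType} (X : normedModType R[i]) l (x : X) :
  rnorm (l *: x) = normc l * rnorm x.
Proof. by apply/(@complexI R); rewrite rmorphM /= -!rnormE normrZ. Qed.

Lemma conj_eq {R : realType} (x y : R[i]) : x^* = y -> x = y^*.
Proof. by move=> <-; rewrite conjCK. Qed.

(** * Orbits of a triangular contraction *)

Section TriangularIsometry.
Context {R : realType}.
Variables (S T : {linear H2 R -> H2 R}) (c : R[i]).
Hypothesis T_contr : forall f, rnorm (T f) <= rnorm f.
Hypothesis T_coef : forall g n,
  (taylor_coef (T g) n)^* = H2_inner (S (mono n)) g.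
Hypothesis c1 : normc c < 1.
Hypothesis S_triang : forall n k, (k < n)%N -> taylor_coef (S (mono n)) k = 0.
Hypothesis S_diag : forall n, taylor_coef (S (mono n)) n = c.
Implicit Types f g h : H2 R.

Definition vanishing f := rnorm (iter n T f) @[n --> \oo] --> (0 : R).

Lemma vanishing_linear l f g : vanishing f -> vanishing g -> vanishing (l *: f + g).
Proof.
move=> vf vg.
apply: (@squeeze0 _ _ (fun n => normc l * rnorm (iter n T f) + rnorm (iter n T g))).
  move=> n; rewrite rnorm_ge0 iter_raddf iter_linearZ /=.
  by apply: le_trans (rnormD _ _) _; rewrite lerD2r rnormZc.
rewrite -(addr0 (0 : R)); apply: cvgD vg.
by rewrite -(mulr0 (normc l)); apply: cvgMl_tmp.
Qed.

Lemma vanishing0 : vanishing 0.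
Proof.
rewrite /vanishing; have -> : (fun n => rnorm (iter n T 0)) = fun=> 0.
  apply/funext; elim=> [|n IH]; first exact: rnorm0.
  by rewrite iterSr linear0.
exact: cvg_cst.
Qed.

(** The matrix of [T] is the conjugate transpose of that of [S], which has no entries [k < n] in
    column [n] and constant diagonal [c]. *)
Lemma T_mono k : T (mono k) = trunc (T (mono k)) k + c^* *: mono k.
Proof.
have coefT n : taylor_coef (T (mono k)) n = (taylor_coef (S (mono n)) k)^*.
  by apply: conj_eq; rewrite T_coef inner_mono_r.
have -> : trunc (T (mono k)) k + c^* *: mono k = trunc (T (mono k)) k.+1.
  by rewrite /trunc big_ord_recr /= coefT S_diag.
apply: taylor_coef_inj; apply/funext => n; rewrite taylor_coef_trunc.
by case: ifPn => //; rewrite -leqNgt coefT => /S_triang ->; rewrite rmorph0.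
Qed.

(** By strong induction the lower monomials in [T (mono k)] have vanishing orbits; they act as the
    error term of a recursion with ratio [normc c < 1]. *)
Lemma vanishing_mono k : vanishing (mono k).
Proof.
elim/ltn_ind: k => k IH.
have vt f N : (N <= k)%N -> vanishing (trunc f N).
  elim: N => [|N IHN] Nk; first by rewrite /trunc big_ord0; exact: vanishing0.
  rewrite /trunc big_ord_recr /= addrC; apply: vanishing_linear; first exact: IH.
  by apply: IHN; exact: ltnW.
have := vt (T (mono k)) k (leqnn k); have := T_mono k.
move: (trunc _ _) => u Tk vu.
apply: (cvg0_geometric_error (normc c) _ _ _ _ _ vu).
- by rewrite normc_ge0.
- by move=> n; exact: rnorm_ge0.
- move=> n; rewrite iterSr Tk iter_raddf iter_linearZ addrC.
  apply: le_trans (rnormD _ _) _; rewrite lerD2r.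
  by rewrite rnormZc normc_conj.
Qed.

Lemma iter_cvg0 f (e : R) : 0 < e -> exists n, rnorm (iter n T f) < e.
Proof.
move=> e0; have e2 : 0 < e / 2 by lra.
have [N /(_ N (leqnn _)) fN] := trunc_cvg f _ e2.
have vt : vanishing (trunc f N).
  elim: N {fN} => [|N IH]; first by rewrite /trunc big_ord0; exact: vanishing0.
  rewrite /trunc big_ord_recr /= addrC.
  by apply: vanishing_linear; [exact: vanishing_mono|exact: IH].
move/cvgrPdist_lt : vt => /(_ _ e2)[M _ /(_ M (leqnn _))].
rewrite sub0r normrN ger0_norm ?rnorm_ge0 // => HM; exists M.
rewrite -[f](subrK (trunc f N)) iter_raddf [ltRHS]splitr.
apply: le_lt_trans (rnormD _ _) (ltrD _ HM).
exact: le_lt_trans (rnorm_iterT T T_contr _ _) fN.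
Qed.

End TriangularIsometry.

(** An isometry alone would not do, as the identity shows; triangularity with a diagonal inside the
    disk is what makes the orbits of the adjoint tend to 0. *)
Theorem residual_adjoint_isometry {R : realType} (S : {linear H2 R -> H2 R}) (c : R[i]) :
  (forall f : H2 R, rnorm (S f) = rnorm f) -> normc c < 1 ->
  (forall n k, (k < n)%N -> taylor_coef (S (mono n)) k = 0) ->
  (forall n, taylor_coef (S (mono n)) n = c) ->
  residual (\bigcap_(l in [set l : R | 1 < l])
    hypercyclic_vectors (fun f : H2 R => l%:C *: H2_adjoint S f)).
Proof.
move=> S_isom c1 tri diag.
pose T : {linear H2 R -> H2 R} := HB.pack (H2_adjoint S)
  (GRing.isLinear.Build _ _ _ _ _ (adjoint_linear S S_isom)).
have [d dd] := @H2_separable R.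
apply: (@residual_common_hypercyclic _ _ T S _ _ _ _ d _ dd).
- exact: adjoint_contraction.
- exact: S_isom.
- exact: adjoint_isometryK.
- exact: (iter_cvg0 S T c (adjoint_contraction S S_isom)
    (taylor_coef_adjoint S S_isom) c1 tri diag).
- exact: H2_complete.
Qed.

(** * Parseval's identity *)

Section TrigonometricIntegrals.
Context {R : realType}.
Notation mu := (@lebesgue_measure R).
Notation D := (`[0, 2 * pi]%classic : set R).

Lemma cos_sin_2npi n : cos (n%:R * (2 * pi)) = 1 :> R /\ sin (n%:R * (2 * pi)) = 0 :> R.
Proof.
have [c2 s2] : cos (2 * pi) = 1 :> R /\ sin (2 * pi) = 0 :> R.
  have -> : 2 * pi = pi + pi :> R by ring.
  rewrite cosD sinD cospi sinpi !mulr0 mul0r mulrNN.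
  by rewrite mulr1 subr0 addr0.
elim: n => [|n [IHc IHs]]; first by rewrite mul0r cos0 sin0.
rewrite -natr1 mulrDl mul1r cosD sinD IHc IHs c2 s2.
by rewrite !mulr0 !mul0r mulr1 subr0 addr0.
Qed.

Lemma two_pi_gt0 : 0 < 2 * pi :> R.
Proof. by rewrite mulr_gt0 // pi_gt0. Qed.

(** Continuity is carried along with the value because additivity of the integral requires
    integrability. *)
Definition has_circle_integral (f : R -> R) v :=
  continuous f /\ \int[mu]_(t in D) f t = v.

Lemma continuous_integrable (f : R -> R) : continuous f ->
  mu.-integrable D (EFin \o f).
Proof.
move=> cf; apply: continuous_compact_integrable; first exact: segment_compact.
exact: continuous_subspaceT.
Qed.

Lemma has_circle_integralD f g u v : has_circle_integral f u ->
  has_circle_integral g v -> has_circle_integral (fun t => f t + g t) (u + v).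
Proof.
move=> [cf <-] [cg <-]; split.
  by move=> t; apply: cvgD; [exact: cf|exact: cg].
by rewrite RintegralD //; exact: continuous_integrable.
Qed.

Lemma has_circle_integral_cst c : has_circle_integral (fun=> c) (2 * pi * c).
Proof.
split; first by move=> t; exact: cvg_cst.
rewrite Rintegral_cst // [X in fine X](lebesgue_measure_itv `[0, 2 * pi]).
by rewrite /= lte_fin two_pi_gt0 -EFinB /= subr0 mulrC.
Qed.

Lemma has_circle_integral_trig (a b : R) k : (0 < k)%N ->
  has_circle_integral (fun t => a * cos (k%:R * t) + b * sin (k%:R * t)) 0.
Proof.
move=> k0; set f := (fun t => _).
have kr : k%:R != 0 :> R by rewrite pnatr_eq0 -lt0n.
have dk (t : R) : is_derive t 1 (fun t : R => k%:R * t) k%:R.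
  apply: is_derive_eq; rewrite /GRing.scale /=; ring.
have dc (t : R) : is_derive t 1 (fun t : R => cos (k%:R * t)) (- sin (k%:R * t) * k%:R).
  exact: (is_derive1_comp (f := cos)).
have ds (t : R) : is_derive t 1 (fun t : R => sin (k%:R * t)) (cos (k%:R * t) * k%:R).
  exact: (is_derive1_comp (f := sin)).
(* A primitive of [f] that takes the same value at 0 and at [2 * pi]. *)
pose F := (fun t => a / k%:R * sin (k%:R * t) - b / k%:R * cos (k%:R * t)).
have dF (t : R) : is_derive t 1 F (f t).
  by apply: is_derive_eq; rewrite /f /= /GRing.scale /=; field.
have cF : continuous F.
  move=> t; apply: differentiable_continuous; apply/derivable1_diffP.
  exact: ex_derive.
have cf : continuous f.
  move=> t; apply: differentiable_continuous; apply/derivable1_diffP.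
  by rewrite /f; apply: derivableD; apply: derivableM; exact: ex_derive.
split => //; rewrite /Rintegral (continuous_FTC2 (F := F) two_pi_gt0) //.
- have [c2 s2] := cos_sin_2npi k; rewrite -EFinB /= /F c2 s2 !mulr0 cos0 sin0.
  by rewrite mulr0 subrr.
- exact: continuous_subspaceT.
- split.
  + by move=> t _; exact: ex_derive.
  + by apply: cvg_at_right_filter; exact: cF.
  + by apply: cvg_at_left_filter; exact: cF.
- by move=> t _; rewrite derive1E; exact: derive_val.
Qed.

End TrigonometricIntegrals.

Section Parseval.
Context {R : realType}.
Notation mu := (@lebesgue_measure R).
Notation D := (`[0, 2 * pi]%classic : set R).
Implicit Types (a b : nat -> R[i]) (f : R[i] -> R[i]).

Lemma expiX (t : R) n : expi t ^+ n = expi (n%:R * t).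
Proof.
elim: n => [|n IH]; first by rewrite mul0r /expi cos0 sin0.
rewrite exprS IH -nat1r mulrDl mul1r /expi cosD sinD; congr (_ +i* _).
by rewrite addrC [cos t * _]mulrC.
Qed.

Lemma normc_expi (t : R) : normc (expi t) = 1.
Proof. by rewrite /= cos2Dsin2 sqrtr1. Qed.

Lemma sqr_normcD (x y : R[i]) :
  normc (x + y) ^+ 2 = normc x ^+ 2 + normc y ^+ 2 + 2 * complex.Re (x * conjc y).
Proof.
by case: x y => [x1 x2] [y1 y2] /=; rewrite !sqr_sqrtr ?addr_ge0 ?sqr_ge0 //; ring.
Qed.

(** The cross term of frequencies [n] and [n + m] is a pure harmonic of frequency [m], so it
    integrates to 0 as soon as [m > 0]. *)
Lemma Re_cross (x y : R[i]) (t : R) n m :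
  complex.Re (x * expi t ^+ n * conjc (y * expi t ^+ (n + m))) =
  complex.Re (x * conjc y) * cos (m%:R * t) +
  complex.Im (x * conjc y) * sin (m%:R * t).
Proof.
have -> : x * expi t ^+ n * conjc (y * expi t ^+ (n + m)) =
    x * conjc y * (expi t ^+ n * conjc (expi t ^+ n)) * conjc (expi t ^+ m).
  by rewrite exprD !rmorphM /=; ring.
rewrite -sqr_normc normcC normcX normc_expi expr1n expr1n mulr1 expiX.
by case: (x * _) => u v /=; ring.
Qed.

Definition trig_poly a N (t : R) := \sum_(n < N) a n * expi t ^+ n.

Lemma parseval_trig_poly a N :
  has_circle_integral (fun t => normc (trig_poly a N t) ^+ 2) (2 * pi * sqsum a N).
Proof.
elim: N => [|N IH].
  have := has_circle_integral_cst (0 : R); rewrite mulr0 sqsum0 mulr0.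
  by under [in X in _ -> X]eq_fun do rewrite /trig_poly big_ord0 normc0 expr0n.
have hs k : (k <= N)%N -> has_circle_integral (fun t => \sum_(n < k)
    (2 * complex.Re (a n * expi t ^+ n * conjc (a N * expi t ^+ N)))) 0.
  elim: k => [|k IHk] kN.
    have := has_circle_integral_cst (0 : R); rewrite mulr0.
    by under [in X in _ -> X]eq_fun do rewrite big_ord0.
  under eq_fun do rewrite big_ord_recr /=.
  rewrite -[X in has_circle_integral _ X](addr0 (0 : R)).
  apply: has_circle_integralD; first by apply: IHk; exact: ltnW.
  have := has_circle_integral_trig (2 * complex.Re (a k * conjc (a N)))
    (2 * complex.Im (a k * conjc (a N))) (N - k)%N; rewrite subn_gt0 => /(_ kN).
  congr has_circle_integral; apply/funext => t.
  rewrite -!mulrA -mulrDr -(Re_cross _ _ _ k) subnKC; last exact: ltnW. by rewrite mulrA.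
have := has_circle_integralD _ _ _ _ (has_circle_integralD _ _ _ _ IH
  (has_circle_integral_cst (normc (a N) ^+ 2))) (hs N (leqnn N)).
rewrite addr0 -mulrDr -sqsumS; congr has_circle_integral.
apply/funext => t; rewrite /trig_poly big_ord_recr /= sqr_normcD.
congr (_ + _ + _); first by rewrite normcM normcX normc_expi expr1n mulr1.
rewrite -mulr_sumr mulr_suml; congr (_ * _).
by rewrite (raddf_sum (@complex.Re R : {additive _ -> _})).
Qed.

End Parseval.

(** * Parseval's identity on circles inside the disk *)

Section ParsevalPowerSeries.
Context {R : realType}.
Notation mu := (@lebesgue_measure R).
Notation D := (`[0, 2 * pi]%classic : set R).
Implicit Types (a b : nat -> R[i]) (f : R[i] -> R[i]).

(** Serves twice: for partial sums on a fixed circle, and for radii tending to 1, where convergence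
    is known only almost everywhere. *)
Lemma bounded_cvg_Rintegral (g_ : nat -> R -> R) (g : R -> R) (C : R) :
  (forall n, measurable_fun D (g_ n)) -> measurable_fun D g ->
  {ae mu, forall t, D t -> g_ n t @[n --> \oo] --> g t} ->
  (forall n t, `|g_ n t| <= C) ->
  (\int[mu]_(t in D) g_ n t) @[n --> \oo] --> \int[mu]_(t in D) g t.
Proof.
move=> mg_ mg cg gC.
have mD : measurable D by [].
have iC : mu.-integrable D (EFin \o (fun=> C)).
  by apply: continuous_integrable => t; exact: cvg_cst.
have mEg_ n : measurable_fun D (EFin \o g_ n) by exact/measurable_EFinP.
have mEg : measurable_fun D (EFin \o g) by exact/measurable_EFinP.
have cEg : {ae mu, forall t, D t -> (EFin \o g_ n) t @[n --> \oo] --> (EFin \o g) t}.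
  apply: (@filterS _ _ (ae_filter_ringOfSetsType mu)) cg => t ct Dt.
  by apply: cvg_EFin; [exact: nearW|exact: ct].
have bEg : {ae mu, forall t n, D t -> (`|(EFin \o g_ n) t| <= (EFin \o (fun=> C)) t)%E}.
  by apply: aeW => t n _; rewrite /= lee_fin.
have [ig _ H] := @dominated_convergence _ (measurableTypeR R) R mu D mD
  (fun n => EFin \o g_ n) _ _ mEg_ mEg cEg iC bEg.
apply: fine_cvg; rewrite /Rintegral fineK; first exact: H.
exact: integrable_fin_num.
Qed.

Lemma radius_bound (r : R) : 0 <= r < 1 -> forall t, `|r%:C * expi t| < 1.
Proof.
move=> /andP[r0 r1] t.
by rewrite normcC normcM normc_expi mulr1 normc_real ger0_norm // ltcR.
Qed.

Lemma abs_summable_disk a f (r : R) : power_series_on_disk a f -> 0 <= r < 1 ->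
  exists2 C : R, 0 <= C & forall n, \sum_(k < n) normc (a k) * r ^+ k <= C.
Proof.
move=> fa /andP[r0 r1].
(* A radius strictly between [r] and 1: the terms of the series at [q] are bounded, which leaves a
   geometric series of ratio [r / q] at [r]. *)
pose q := (1 + r) / 2.
have q0 : 0 < q by rewrite /q; lra.
have q1 : q < 1 by rewrite /q; lra.
have rq : r < q by rewrite /q; lra.
have qz : `|q%:C| < 1 :> R[i] by rewrite normcC normc_real gtr0_norm // ltcR.
have : (fun n => a n * q%:C ^+ n) @ \oo --> (0 : R[i]).
  apply: cvg_series_cvg_0; apply/cvg_ex; exists (f q%:C); exact: fa.
move=> /cvg_rnormP; under eq_fun do rewrite subr0 rnormc normcM normcX normc_real.
move=> cz.
have /cvg_seq_bounded/ex_strict_bound_gt0[M M0 HM] :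
    cvgn (fun n => normc (a n) * `|q| ^+ n) by apply/cvg_ex; exists 0.
have le n : normc (a n) * r ^+ n <= M * (r / q) ^+ n.
  have := HM n I.
  rewrite /= (gtr0_norm q0) ger0_norm ?mulr_ge0 ?normc_ge0 ?exprn_ge0 ?(ltW q0) //.
  move=> /ltW h; rewrite expr_div_n [leRHS]mulrA ler_pdivlMr ?exprn_gt0 //.
  by rewrite mulrAC ler_wpM2r // exprn_ge0.
have rq01 : 0 <= r / q < 1.
  by rewrite divr_ge0 ?(ltW q0) //= ltr_pdivrMr // mul1r.
exists (M / (1 - r / q)).
  by rewrite divr_ge0 ?(ltW M0) // subr_ge0; case/andP: rq01 => _ /ltW.
move=> n; apply: le_trans (ler_sum _ (fun (k : 'I_n) _ => le k)) _.
have cg := geometric_cvg M _ rq01.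
rewrite -(cvg_lim _ cg) //.
have -> : \sum_(k < n) M * (r / q) ^+ k = series (fun n => M * (r / q) ^+ n) n.
  by rewrite seriesEord.
apply: nondecreasing_cvgn_le; last by apply/cvg_ex; eexists; exact: cg.
apply/nondecreasing_seqP => k; rewrite seriesSr lerDl.
by rewrite mulr_ge0 ?(ltW M0) // exprn_ge0 //; case/andP: rq01.
Qed.

Lemma cvg_normc {T : Type} (F : set_system T) {FF : Filter F}
    (u : T -> R[i]) (l : R[i]) :
  u x @[x --> F] --> l -> normc (u x) @[x --> F] --> normc l.
Proof.
move=> /cvg_rnormP/cvgrPdist_lt ul; apply/cvgrPdist_lt => e /ul; apply: filterS => x.
rewrite sub0r normrN ger0_norm ?rnorm_ge0 // rnormc; apply: le_lt_trans.
have := normc_triangle (u x - l) l; have := normc_triangle (l - u x) (u x).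
rewrite !subrK (normc_distC l) => h1 h2.
by rewrite ler_norml; apply/andP; split; lra.
Qed.

(** No square-summability of [a] is assumed: for [phi] times a polynomial it will be a consequence
    of this identity. *)
Lemma parseval a f (r : R) : power_series_on_disk a f -> 0 <= r < 1 ->
  measurable_fun D (fun t => normc (f (r%:C * expi t)) ^+ 2) /\
  (fun n => 2 * pi * sqsum (fun k => a k * r%:C ^+ k) n) @ \oo -->
    \int[mu]_(t in D) (normc (f (r%:C * expi t)) ^+ 2).
Proof.
move=> fa r01; set b := fun k => a k * r%:C ^+ k.
have [C C0 HC] := abs_summable_disk _ _ _ fa r01.
have cvt t : normc (trig_poly b n t) ^+ 2 @[n --> \oo] -->
    normc (f (r%:C * expi t)) ^+ 2.
  have := fa _ (radius_bound _ r01 t).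
  have -> : series (fun n => a n * (r%:C * expi t) ^+ n) = (fun n => trig_poly b n t).
    apply/funext => n; rewrite seriesEord /=; apply: eq_bigr => i _.
    by rewrite /b exprMn mulrA.
  by move=> /cvg_normc h; exact: (cvgM h h).
have mt n : measurable_fun D (fun t => normc (trig_poly b n t) ^+ 2).
  apply: measurable_funTS; apply: continuous_measurable_fun.
  exact: (parseval_trig_poly b n).1.
have mf : measurable_fun D (fun t => normc (f (r%:C * expi t)) ^+ 2).
  by apply: (measurable_fun_cvg mt) => t _; exact: cvt.
split=> //.
have -> : (fun n => 2 * pi * sqsum b n) =
    (fun n => \int[mu]_(t in D) (normc (trig_poly b n t) ^+ 2)).
  by apply/funext => n; have [_ ->] := parseval_trig_poly b n.
apply: (bounded_cvg_Rintegral _ _ (C ^+ 2) mt mf).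
  by apply: aeW => t _; exact: cvt.
move=> n t; rewrite ger0_norm ?sqr_ge0 // ler_sqr ?nnegrE ?normc_ge0 //.
apply: le_trans (HC n); rewrite /trig_poly; apply: le_trans (normc_sum _ _ _) _.
apply: ler_sum => k _; case/andP: r01 => r0 _.
by rewrite /b !normcM !normcX normc_expi expr1n mulr1 normc_real ger0_norm.
Qed.

End ParsevalPowerSeries.

(** * Multiplication by an inner function *)

Section InnerMultiplication.
Context {R : realType}.
Notation mu := (@lebesgue_measure R).
Notation D := (`[0, 2 * pi]%classic : set R).
Implicit Types (a b p : nat -> R[i]) (f phi : R[i] -> R[i]).

Lemma eq_power_series a b f g : a =1 b -> f =1 g ->
  power_series_on_disk a f -> power_series_on_disk b g.
Proof. by move=> /funext -> /funext ->. Qed.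

Lemma power_series_mulX a f : power_series_on_disk a f ->
  power_series_on_disk (fun n => if n is m.+1 then a m else 0) (fun z => z * f z).
Proof.
move=> fa z z1; rewrite -(@cvg_shiftS _ _ (fun n => _)).
have -> : [sequence series (fun n => (if n is m.+1 then a m else 0) * z ^+ n) n.+1]_n =
    (fun n => z * series (fun n => a n * z ^+ n) n).
  apply/funext => n; rewrite !seriesEord /= big_ord_recl /= mul0r add0r mulr_sumr.
  by apply: eq_bigr => i _; rewrite /= /bump /= exprS mulrCA.
by apply: (@cvgMl_tmp R[i] nat \oo _ _ z (f z)); exact: fa.
Qed.

Lemma power_series_mulXn a f j : power_series_on_disk a f ->
  power_series_on_disk (fun n => if (j <= n)%N then a (n - j)%N else 0)
    (fun z => f z * z ^+ j).
Proof.
move=> fa; elim: j => [|j /power_series_mulX]; [move: fa|]; apply: eq_power_series.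
- by move=> n; rewrite subn0.
- by move=> z; rewrite expr0 mulr1.
- by case.
- by move=> z; rewrite exprS mulrCA.
Qed.

(** The Cauchy product of [c] with the polynomial of coefficients [p j], [j < N]: a finite
    combination of shifts of [c], so that no product of two infinite series arises. *)
Definition mulpoly c p N n : R[i] :=
  \sum_(j < N) p j * (if (j <= n)%N then c (n - j)%N else 0).

Lemma power_series_mulpoly c p N phi : power_series_on_disk c phi ->
  power_series_on_disk (mulpoly c p N) (fun z => phi z * \sum_(j < N) p j * z ^+ j).
Proof.
move=> ca; elim: N => [|N IH].
  apply: eq_power_series power_series0 => [n|z]; first by rewrite /mulpoly big_ord0.
  by rewrite big_ord0 mulr0.
have := power_seriesD IH (power_seriesZ (l := p N) (power_series_mulXn _ _ N ca)).
apply: eq_power_series => [n|z] /=; first by rewrite /mulpoly big_ord_recr.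
by rewrite big_ord_recr /= mulrDr [p N * (_ * _)]mulrCA.
Qed.

(** A sequence of radii stands for the limit at [1^'-], since dominated convergence is applied along
    sequences. *)
Definition radius (m : nat) : R := 1 - m.+1%:R^-1.

Lemma radius01 m : 0 <= radius m < 1.
Proof.
rewrite /radius subr_ge0 invf_le1 ?ltr0n // ler1n /=.
by rewrite gtrBl invr_gt0 ltr0n.
Qed.

Lemma radius_cvg : radius @ \oo --> (1 : R).
Proof.
rewrite -(subr0 (1 : R)); apply: cvgB; first exact: cvg_cst.
exact: cvg_harmonic.
Qed.

Lemma radius_at_left : radius @ \oo --> (1 : R)^'-.
Proof.
move=> A /radius_cvg[N _ HN]; exists N => // m /HN; apply.
by case/andP: (radius01 m).
Qed.

Lemma radial_poly_cvg p N (t : R) :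
  \sum_(j < N) p j * ((radius m)%:C * expi t) ^+ j @[m --> \oo] --> trig_poly p N t.
Proof.
have rw : (radius m)%:C * expi t @[m --> \oo] --> expi t.
  apply/cvg_rnormP.
  have -> : (fun m => rnorm ((radius m)%:C * expi t - expi t)) = harmonic.
    apply/funext => m; rewrite -[X in _ - X]mul1r -mulrBl rnormc normcM normc_expi.
    rewrite mulr1 -(rmorph1 (real_complex R)) -rmorphB normc_real /radius.
    by rewrite addrAC subrr add0r normrN ger0_norm // invr_ge0 ler0n.
  exact: cvg_harmonic.
have rX j : ((radius m)%:C * expi t) ^+ j @[m --> \oo] --> expi t ^+ j.
  elim: j => [|j IH]; first by rewrite expr0; exact: cvg_cst.
  rewrite exprS; under eq_fun do rewrite exprS.
  by apply: (@cvgM R[i]); [exact: rw|exact: IH].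
elim: N => [|N IH].
  by under eq_fun do rewrite big_ord0; rewrite /trig_poly big_ord0; exact: cvg_cst.
under eq_fun do rewrite big_ord_recr /=.
rewrite /trig_poly big_ord_recr /=; apply: cvgD; first exact: IH.
by apply: (@cvgM R[i]); [exact: cvg_cst|exact: rX].
Qed.

End InnerMultiplication.

(** * Products of an inner function with polynomials *)

Section InnerIsometry.
Context {R : realType}.
Notation mu := (@lebesgue_measure R).
Notation D := (`[0, 2 * pi]%classic : set R).
Implicit Types (a b c p : nat -> R[i]) (f phi : R[i] -> R[i]).

Lemma sqsum_radius_le b (r : R) n : 0 <= r < 1 ->
  sqsum (fun k => b k * r%:C ^+ k) n <= sqsum b n.
Proof.
move=> /andP[r0 r1]; apply: sqsum_mono => k _.
rewrite normcM normcX normc_real ger0_norm // ler_piMr ?normc_ge0 //.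
by rewrite exprn_ile1 // ltW.
Qed.

Lemma cvgM_eq (u v : nat -> R) (x y z : R) : u @ \oo --> x -> v @ \oo --> y ->
  x * y = z -> (fun n => u n * v n) @ \oo --> z.
Proof. by move=> ux vy <-; exact: cvgM. Qed.

Lemma sqsum_radius_cvg b n :
  sqsum (fun k => b k * (radius m)%:C ^+ k) n @[m --> \oo] --> sqsum b n.
Proof.
elim: n => [|n IH].
  by under eq_fun do rewrite sqsum0; rewrite sqsum0; exact: cvg_cst.
under eq_fun do rewrite sqsumS; rewrite sqsumS; apply: cvgD; first exact: IH.
have rX k : radius m ^+ k @[m --> \oo] --> (1 : R).
  elim: k => [|k IHk]; first by under eq_fun do rewrite expr0; exact: cvg_cst.
  under eq_fun do rewrite exprS; by apply: cvgM_eq (@radius_cvg R) IHk _; rewrite mulr1.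
have E m : normc (b n * (radius m)%:C ^+ n) ^+ 2 = normc (b n) ^+ 2 * radius m ^+ (n * 2).
  case/andP: (@radius01 R m) => r0 _.
  by rewrite normcM normcX normc_real ger0_norm // exprMn exprM.
under eq_fun do rewrite E.
by apply: cvgM_eq (cvg_cst _) (rX _) _; rewrite mulr1.
Qed.

(** The circle means [G] of [phi * P] are computed in two ways: Parseval expresses them by the
    coefficients [b] damped by powers of the radius, and dominated convergence gives their limit,
    the mean of the polynomial alone. *)
Lemma inner_mulpoly_isometry c p N phi : inner_function phi ->
  power_series_on_disk c phi ->
  square_summable (mulpoly c p N) /\
  l2norm (mulpoly c p N) = Num.sqrt (sqsum p N).
Proof.
move=> [_ [M phiM] phi1] cphi.
set b := mulpoly c p N.
pose P z : R[i] := \sum_(j < N) p j * z ^+ j.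
have bP : power_series_on_disk b (fun z => phi z * P z).
  exact: power_series_mulpoly.
pose G m := \int[mu]_(t in D)
  (normc (phi ((radius m)%:C * expi t) * P ((radius m)%:C * expi t)) ^+ 2).
have pars m := parseval _ _ _ bP (@radius01 R m).
have pi0 := @two_pi_gt0 R.
have GS : G @ \oo --> 2 * pi * sqsum p N.
  have [cP <-] := parseval_trig_poly p N.
  pose C := \sum_(j < N) normc (p j).
  have PC z : normc z < 1 -> normc (P z) <= C.
    move=> z1; apply: le_trans (normc_sum _ _ _) _; apply: ler_sum => j _.
    rewrite normcM normcX ler_piMr ?normc_ge0 // exprn_ile1 ?normc_ge0 //.
    exact: ltW.
  apply: (bounded_cvg_Rintegral _ _ ((M * C) ^+ 2)).
  - by move=> m; case: (pars m).
  - by apply: measurable_funTS; apply: continuous_measurable_fun.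
  - apply: (@filterS _ _ (ae_filter_ringOfSetsType mu)) phi1 => t Ht Dt.
    have [w w1 /(cvg_comp _ _ (@radius_at_left R)) /cvg_normc wc] := Ht Dt.
    have Pc : normc (P ((radius m)%:C * expi t)) @[m --> \oo] -->
        normc (trig_poly p N t) by apply: cvg_normc; exact: radial_poly_cvg.
    have w1' : normc w = 1 by apply/complexI; rewrite -normcC w1.
    rewrite w1' in wc.
    under eq_fun do rewrite normcM expr2.
    have h := cvgM_eq _ _ _ _ _ wc Pc (mul1r _).
    exact: (cvgM_eq _ _ _ _ _ h h).
  - move=> m t; have := radius_bound _ (@radius01 R m) t; set z := _ * expi t => z1.
    rewrite ger0_norm ?sqr_ge0 // lerXn2r ?nnegrE ?normc_ge0 //.
      apply: (@le_trans _ _ (normc (phi z * P z))); first exact: normc_ge0.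
      rewrite normcM; apply: ler_pM; rewrite ?normc_ge0 //.
        by have := phiM z z1; rewrite normcC lecR.
      by apply: PC; rewrite -ltcR -normcC.
    rewrite normcM; apply: ler_pM; rewrite ?normc_ge0 //.
      by have := phiM z z1; rewrite normcC lecR.
    by apply: PC; rewrite -ltcR -normcC.
have nd m : nondecreasing_seq (fun n => 2 * pi * sqsum (fun k => b k * (radius m)%:C ^+ k) n).
  by move=> i j ij; rewrite ler_pM2l //; exact: sqsum_nd.
(* The section length [n] is fixed before the radius tends to 1, so only finitely many damping
   factors have to converge. *)
have lo n : sqsum b n <= sqsum p N.
  rewrite -(ler_pM2l pi0).
  have cb : 2 * pi * sqsum (fun k => b k * (radius m)%:C ^+ k) n @[m --> \oo] -->
      2 * pi * sqsum b n.
    by apply: cvgM; [exact: cvg_cst|exact: sqsum_radius_cvg].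
  apply: (ler_cvg_to cb GS); apply: nearW => m; have [_ cG] := pars m.
  rewrite /G -(cvg_lim _ cG) //.
  by apply: nondecreasing_cvgn_le; [exact: nd|apply/cvg_ex; eexists; exact: cG].
have S0 := sqsum_ge0 p N.
have [cb _] : square_summable b /\ l2norm b <= Num.sqrt (sqsum p N).
  by apply: sqsum_bound; [exact: sqrtr_ge0|move=> n; rewrite ler_wsqrtr].
split=> //; congr Num.sqrt; apply/le_anti/andP; split.
  by apply: limr_le => //; exact: nearW.
(* Conversely damping only decreases the sums, so every [G m] is at most the undamped total, which
   is finite by now. *)
rewrite -(ler_pM2l pi0); apply: (ler_cvg_to GS (cvg_cst _)); apply: nearW => m.
have [_ cG] := pars m; rewrite /G -(cvg_lim _ cG) //.
apply: limr_le; first by apply/cvg_ex; eexists; exact: cG.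
apply: nearW => n; rewrite ler_pM2l //; apply: le_trans (sqsum_radius_le _ _ _ (@radius01 R m)) _.
exact: nondecreasing_cvgn_le (sqsum_nd b) cb n.
Qed.

End InnerIsometry.

(** * From polynomials to the whole Hardy space *)

Section Multiplier.
Context {R : realType}.
Variables (phi : R[i] -> R[i]) (c : nat -> R[i]).
Hypothesis phi_inner : inner_function phi.
Hypothesis c_phi : power_series_on_disk c phi.
Implicit Types f g h : H2 R.

Lemma eq_mulpoly (p q : nat -> R[i]) N K : (N <= K)%N ->
  (forall j, (j < K)%N -> q j = if (j < N)%N then p j else 0) ->
  mulpoly c q K = mulpoly c p N.
Proof.
move=> NK qE; apply/funext => n; rewrite /mulpoly.
rewrite -(big_mkord xpredT (fun j => q j * (if (j <= n)%N then c (n - j)%N else 0))).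
rewrite (big_cat_nat _ (n := N)) //= [X in _ + X]big_nat [X in _ + X]big1 ?addr0.
  rewrite big_mkord; apply: eq_bigr => j _.
  by rewrite qE ?ltn_ord // (leq_trans (ltn_ord j)).
by move=> j /andP[Nj jK]; rewrite qE // ltnNge Nj mul0r.
Qed.

Lemma mulpolyB (p q : nat -> R[i]) N n :
  mulpoly c (fun j => p j - q j) N n = mulpoly c p N n - mulpoly c q N n.
Proof. by rewrite /mulpoly -sumrB; apply: eq_bigr => j _; rewrite mulrBl. Qed.

(** The products [u N] of [phi] with the truncations of [f] form a Cauchy sequence by the isometry
    on polynomials. Bounded point evaluation identifies their limit with [phi * f] on the disk. *)
Lemma mul_inner f : exists g : H2 R,
  (forall z, `|z| < 1 -> g z = phi z * f z) /\ rnorm g = rnorm f.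
Proof.
set p := taylor_coef f; have [fp cp] := H2_taylor f.
pose u N : H2 R := of_coef (mulpoly c p N).
have coefu N : taylor_coef (u N) = mulpoly c p N.
  by rewrite of_coefK //; case: (inner_mulpoly_isometry c p N phi phi_inner c_phi).
have uN N : rnorm (u N) = Num.sqrt (sqsum p N).
  by rewrite rnormH2 coefu; case: (inner_mulpoly_isometry c p N phi phi_inner c_phi).
(* Truncations of different lengths are padded with zeros to the common length [N + M], where
   [mulpoly] is additive. *)
have aux N M q1 q2 : (forall j, q1 j = if (j < N)%N then p j else 0) ->
    (forall j, q2 j = if (j < M)%N then p j else 0) ->
    (fun n => mulpoly c p N n - mulpoly c p M n) =
    mulpoly c (fun j => q1 j - q2 j) (N + M).
  move=> q1E q2E; apply/funext => n; rewrite mulpolyB.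
  by rewrite (eq_mulpoly p q1 N) ?leq_addr // (eq_mulpoly p q2 M) ?leq_addl.
have udist N M : rnorm (u N - u M) <= rnorm (trunc f N - trunc f M).
  pose K := (N + M)%N; set h := trunc f N - trunc f M.
  have -> : rnorm (u N - u M) = Num.sqrt (sqsum (taylor_coef h) K).
    have [_ <-] := inner_mulpoly_isometry c (taylor_coef h) K phi phi_inner c_phi.
    rewrite rnormH2 !taylor_coefB !coefu; congr l2norm; apply: aux.
      exact: taylor_coef_trunc.
    exact: taylor_coef_trunc.
  rewrite rnormH2; apply: sqsum_le; exact: (H2_taylor h).2.
have cu : rcauchy u.
  move=> e e0; have e2 : 0 < e / 2 by lra.
  have [N HN] := trunc_cvg f _ e2; exists N => m n Nm Nn.
  apply: le_lt_trans (udist m n) _.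
  apply: le_lt_trans (rnorm_distD f _ _) _.
  rewrite rnorm_distC [ltRHS]splitr; apply: ltrD; exact: HN.
have [g ug] := H2_complete _ cu.
have ugr : rnorm (u n - g) @[n --> \oo] --> (0 : R).
  apply/cvgrPdist_lt => e /ug[N HN]; exists N => // n /HN.
  by rewrite sub0r normrN ger0_norm // rnorm_ge0.
exists g; split.
  move=> z z1.
  have uz N : u N z = phi z * \sum_(j < N) p j * z ^+ j.
    have := (H2_taylor (u N)).1 z z1; rewrite coefu => h1.
    apply: cvgc_unique h1 _.
    exact: (power_series_mulpoly c p N phi c_phi z z1).
  have lim1 : u N z @[N --> \oo] --> phi z * f z.
    under eq_fun do rewrite uz.
    apply: (@cvgMl_tmp R[i] nat \oo _ _ (phi z) (f z)).
    have -> : (fun n => \sum_(j < n) p j * z ^+ j) = series (fun n => p n * z ^+ n).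
      by apply/funext => n; rewrite seriesEord.
    exact: fp.
  apply: cvgc_unique lim1; apply/cvg_rnormP.
  have z1' : 0 < 1 - normc z by rewrite subr_gt0 -ltcR -normcC.
  apply: (@squeeze0 _ _ (fun N => rnorm (u N - g) / (1 - normc z))).
    move=> n; rewrite rnorm_ge0 /= rnormc.
    exact: (eval_le (u n - g) z z1).
  by apply: cvgM_eq ugr (cvg_cst _) _; rewrite mul0r.
have ng : rnorm (u n) @[n --> \oo] --> rnorm g.
  apply/cvgrPdist_lt => e /ug[N HN]; exists N => // n /HN; apply: le_lt_trans.
  have := rnormD (u n - g) g; have := rnormD (g - u n) (u n).
  rewrite !subrK (rnorm_distC g (u n)).
  move: (rnorm (u n - g)) (rnorm g) (rnorm (u n)) => x y w h1 h2.
  by rewrite ler_norml; apply/andP; split; lra.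
have := cvgM_eq _ _ _ _ _ ng ng erefl.
under eq_fun do rewrite -expr2 uN sqr_sqrtr ?sqsum_ge0 //.
rewrite -expr2 => sg.
have E : rnorm g ^+ 2 = limn (sqsum p).
  by apply/esym; apply: cvg_lim sg; exact: norm_hausdorff.
have {}E := etrans E (esym (sqr_l2norm p)).
have p0 := l2norm_ge0 p; have g0 := rnorm_ge0 g.
rewrite (rnormH2 f) -/p; move: (rnorm g) (l2norm p) E p0 g0 => x y /eqP + y0 x0.
by rewrite eqrXn2 // => /eqP.
Qed.

Lemma H2_outside (f : H2 R) z : ~~ (`|z| < 1) -> f z = 0.
Proof. by move=> z1; case: f => f /= /set_mem[+ _]; apply. Qed.

(** Since [f] is 0 outside the disk, so is the product; it is thus the underlying function of the
    [g] found before, and [insubd] does not fall back on its default. *)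
Lemma multiplierP f : (forall z, multiplier phi f z = phi z * f z) /\
  rnorm (multiplier phi f) = rnorm f.
Proof.
have [g [gz gf]] := mul_inner f.
have -> : multiplier phi f = g.
  rewrite /multiplier (_ : (fun z => _) = \val g); first exact: valKd.
  apply/funext => z; have [z1|z1] := boolP (`|z| < 1); first by rewrite -gz.
  rewrite (H2_outside f z z1) mulr0; exact: (esym (H2_outside g z z1)).
split; last exact: gf.
move=> z; have [z1|z1] := boolP (`|z| < 1); first exact: gz.
by rewrite (H2_outside g z z1) (H2_outside f z z1) mulr0.
Qed.

Lemma multiplier_linear : linear (multiplier phi : H2 R -> H2 R).
Proof.
have aux (k l x y a b : R[i]) : a = k * x -> b = k * y ->
    k * (l * x + y) = l * a + b.
  by move=> -> ->; rewrite mulrDr mulrCA.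
move=> l f g; apply: val_inj; apply/funext => z.
apply: (etrans ((multiplierP (l *: f + g)).1 z)).
change (phi z * (l * f z + g z) = l * multiplier phi f z + multiplier phi g z).
exact: aux ((multiplierP f).1 z) ((multiplierP g).1 z).
Qed.

Lemma mono_eval n z : `|z| < 1 -> (mono n : H2 R) z = z ^+ n.
Proof.
move=> z1; apply: cvgc_unique ((H2_taylor (mono n)).1 z z1) _.
have -> : z ^+ n = taylor_coef (mono n : H2 R) n * z ^+ n.
  by rewrite taylor_coef_mono eqxx mul1r.
apply: (cvg_series_single (fun k => taylor_coef (mono n : H2 R) k * z ^+ k)) => k.
by move=> /negbTE kn; rewrite taylor_coef_mono kn mul0r.
Qed.

Lemma taylor_coef_multiplier_mono n :
  taylor_coef (multiplier phi (mono n)) =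
  fun k => if (n <= k)%N then c (k - n)%N else 0.
Proof.
apply: taylor_coefE => z z1; rewrite (multiplierP _).1 mono_eval //.
exact: power_series_mulXn c_phi z z1.
Qed.

Lemma inner_coef0_lt1 : ~ constant_on_disk phi -> normc (c 0%N) < 1.
Proof.
move=> ncst; rewrite ltNge; apply/negP => c0; apply: ncst; exists (c 0%N) => z z1.
(* The isometry applied to the constant polynomial 1 says that [c] has l2 norm 1; a first
   coefficient of modulus at least 1 then leaves no room for the others. *)
have mE : mulpoly c (fun=> 1) 1 = c.
  by apply/funext => n; rewrite /mulpoly big_ord1 mul1r subn0.
have [+ +] := inner_mulpoly_isometry c (fun=> 1) 1 phi phi_inner c_phi.
rewrite mE sqsumS sqsum0 add0r normc1 expr1n sqrtr1 => cc c1.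
have cn n : n != 0%N -> c n = 0.
  case: n => // n _; apply: eq0_normc.
  have h : sqsum c n.+2 <= 1.
    by rewrite -ler_sqrt // sqrtr1 -[leRHS]c1; exact: sqsum_le.
  have h0 : 1 <= sqsum c n.+1.
    apply: (@le_trans _ _ (sqsum c 1)); last exact: sqsum_nd.
    by rewrite sqsumS sqsum0 add0r exprn_ege1.
  rewrite sqsumS in h.
  apply/eqP; rewrite -sqrf_eq0; apply/eqP/le_anti; rewrite sqr_ge0 andbT.
  by move: h h0; move: (_ ^+ 2) (sqsum _ _) => x y; lra.
apply: cvgc_unique (c_phi z z1) _.
have -> : c 0%N = c 0%N * z ^+ 0 by rewrite mulr1.
by apply: (cvg_series_single (fun k => c k * z ^+ k)) => k /cn ->; rewrite mul0r.
Qed.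

End Multiplier.

Theorem corollary3 (R : realType) (phi : R[i] -> R[i])
    (phi_inner : inner_function phi)
    (phi_nonconstant : ~ constant_on_disk phi) :
  residual (\bigcap_(lambda in [set lambda : R | 1 < lambda])
    hypercyclic_vectors
      (fun f : H2 R => lambda%:C *: H2_adjoint (multiplier phi) f)).
Proof.
have [[c c_phi] _ _] := phi_inner.
pose S : {linear H2 R -> H2 R} := HB.pack (multiplier phi : H2 R -> H2 R)
  (GRing.isLinear.Build _ _ _ _ _ (multiplier_linear _ _ phi_inner c_phi)).
apply: (residual_adjoint_isometry S (c 0%N)).
- by move=> f; case: (multiplierP _ _ phi_inner c_phi f).
- exact: inner_coef0_lt1 phi_inner c_phi phi_nonconstant.
- move=> n k kn; rewrite [taylor_coef _](taylor_coef_multiplier_mono _ _ phi_inner c_phi).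
  by rewrite leqNgt kn.
- move=> n; rewrite [taylor_coef _](taylor_coef_multiplier_mono _ _ phi_inner c_phi).
  by rewrite leqnn subnn.
Qed.
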